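(* Let $\mathbf{C}_{\phi,\omega}=(C_{\phi_1,\omega_1},C_{\phi_2,\omega_2})$ be the $2$-variable weighted shift given by positive sequences $\{\alpha_{(n,m)}\}$ and $\{\beta_{(n,m)}\}$, $(n,m)\in\mathbb{Z}_+\times\mathbb{Z}_+$. Let $\lambda\in(0,1)$ and $p\in(0,1]$. Then: (i) $\mathbf{C}_{\phi,\omega}$ is spherically $p$-hyponormal if and only if $\alpha_{(n-1,m)}^2+\beta_{(n,m-1)}^2\le\alpha_{(n,m)}^2+\beta_{(n,m)}^2$ for all $(n,m)\in\mathbb{Z}_+\times\mathbb{Z}_+$, where $\alpha_{(-1,m)}=\beta_{(n,-1)}=0$ for $n,m\in\mathbb{Z}_+$. (ii) $\mathcal{M}_\lambda(\mathbf{C}_{\phi,\omega})=(C_{\phi_1,\omega_\lambda^1},C_{\phi_2,\omega_\lambda^2})$ is a $2$-variable weighted shift with domain $\mathcal{D}(\mathcal{M}_\lambda(\mathbf{C}_{\phi,\omega}))=\{f:\sum_{(n,m)}|f(n,m)|^2g(n,m)<\infty\}$, where $$g(n,m)=1+\alpha_{(n,m)}^2+\beta_{(n,m)}^2+\frac{\alpha_{(n,m)}^2(\alpha_{(n+1,m)}^2+\beta_{(n+1,m)}^2)+\beta_{(n,m)}^2(\alpha_{(n,m+1)}^2+\beta_{(n,m+1)}^2)}{\alpha_{(n,m)}^2+\beta_{(n,m)}^2},$$ and its weight functions are $\omega_\lambda^1(n,m)=\widetilde{\alpha_{(n-1,m)}}$ for $n\ge1$, $\omega_\lambda^1(0,m)=0$;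 $\omega_\lambda^2(n,m)=\widetilde{\beta_{(n,m-1)}}$ for $m\ge1$, $\omega_\lambda^2(n,0)=0$, where the positive sequences are $$\widetilde{\alpha_{(n,m)}}=\Big((1-\lambda)\sqrt{\tfrac{\alpha_{(n+1,m)}^2+\beta_{(n+1,m)}^2}{\alpha_{(n,m)}^2+\beta_{(n,m)}^2}}+\lambda\Big)\alpha_{(n,m)},\qquad \widetilde{\beta_{(n,m)}}=\Big((1-\lambda)\sqrt{\tfrac{\alpha_{(n,m+1)}^2+\beta_{(n,m+1)}^2}{\alpha_{(n,m)}^2+\beta_{(n,m)}^2}}+\lambda\Big)\beta_{(n,m)}.$$ (iii) $\mathcal{M}_\lambda(\mathbf{C}_{\phi,\omega})$ is spherically $p$-hyponormal if and only if for all $(n,m)\in\mathbb{Z}_+\times\mathbb{Z}_+$ $$\Big((1-\lambda)\sqrt{\tfrac{\alpha_{(n,m)}^2+\beta_{(n,m)}^2}{\alpha_{(n-1,m)}^2+\beta_{(n-1,m)}^2}}+\lambda\Big)^2\alpha_{(n-1,m)}^2+\Big((1-\lambda)\sqrt{\tfrac{\alpha_{(n,m)}^2+\beta_{(n,m)}^2}{\alpha_{(n,m-1)}^2+\beta_{(n,m-1)}^2}}+\lambda\Big)^2\beta_{(n,m-1)}^2$$ $$\le\Big((1-\lambda)\sqrt{\tfrac{\alpha_{(n+1,m)}^2+\beta_{(n+1,m)}^2}{\alpha_{(n,m)}^2+\beta_{(n,m)}^2}}+\lambda\Big)^2\alpha_{(n,m)}^2+\Big((1-\lambda)\sqrt{\tfrac{\alpha_{(n,m+1)}^2+\beta_{(n,m+1)}^2}{\alpha_{(n,m)}^2+\beta_{(n,m)}^2}}+\lambda\Big)^2\beta_{(n,m)}^2,$$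 where the first summand on the left is read as $0$ if $n=0$ and the second summand on the left is read as $0$ if $m=0$. (iv) The $\lambda$-spherical mean transform preserves the spherical $p$-hyponormality of $\mathbf{C}_{\phi,\omega}$ (i.e. if $\mathbf{C}_{\phi,\omega}$ is spherically $p$-hyponormal then so is $\mathcal{M}_\lambda(\mathbf{C}_{\phi,\omega})$) if the sequences satisfy: (a) $\alpha_{(n+1,m)}=\alpha_{(n,m+1)}$ and $\beta_{(n+1,m)}=\beta_{(n,m+1)}$ for all $n,m\ge0$; (b) for every fixed $m\ge0$, $\{\alpha_{(n,m)}^2+\beta_{(n,m)}^2\}_n$ is a Stieltjes moment sequence in $n$.
   Context: Let $X=\mathbb{Z}_+\times\mathbb{Z}_+$ ($\mathbb{Z}_+=\{0,1,2,\dots\}$) with the $\sigma$-algebra $2^X$ and the counting measure $\mu$. For $\phi:X\to X$ and $\omega:X\to\mathbb{C}$, the weighted composition operator $C_{\phi,\omega}$ in $L^2(\mu)=\ell^2(X)$ has domain $\{f\in L^2(\mu):\omega\cdot(f\circ\phi)\in L^2(\mu)\}$ and acts by $C_{\phi,\omega}f=\omega\cdot(f\circ\phi)$. Given positive (not necessarily bounded) sequences $\{\alpha_{(n,m)}\}$, $\{\beta_{(n,m)}\}$ indexed by $X$, the $2$-variable weighted shift is the pair $(C_{\phi_1,\omega_1},C_{\phi_2,\omega_2})$ with $\phi_1(n,m)=(n-1,m)$ for $n\ge1$, $\phi_1(0,m)=(0,m)$; $\phi_2(n,m)=(n,m-1)$ for $m\ge1$, $\phi_2(n,0)=(n,0)$;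 $\omega_1(n,m)=\alpha_{(n-1,m)}$ for $n\ge1$, $\omega_1(0,m)=0$; $\omega_2(n,m)=\beta_{(n,m-1)}$ for $m\ge1$, $\omega_2(n,0)=0$. (Thus $C_{\phi_1,\omega_1}e_{(n,m)}=\alpha_{(n,m)}e_{(n+1,m)}$ and $C_{\phi_2,\omega_2}e_{(n,m)}=\beta_{(n,m)}e_{(n,m+1)}$; both are densely defined. No commutativity is assumed.) A pair is identified with the column operator $f\mapsto\binom{C_{\phi_1,\omega_1}f}{C_{\phi_2,\omega_2}f}$ with domain $\mathcal{D}(C_{\phi_1,\omega_1})\cap\mathcal{D}(C_{\phi_2,\omega_2})$; it is densely defined and closed if both components are densely defined. With polar decomposition $\mathbf{C}_{\phi,\omega}=\binom{U_1}{U_2}|\mathbf{C}_{\phi,\omega}|$, the $\lambda$-spherical mean transform is $$\mathcal{M}_\lambda(\mathbf{C}_{\phi,\omega})=\big(\lambda U_1|\mathbf{C}_{\phi,\omega}|+(1-\lambda)|\mathbf{C}_{\phi,\omega}|U_1,\ \lambda U_2|\mathbf{C}_{\phi,\omega}|+(1-\lambda)|\mathbf{C}_{\phi,\omega}|U_2\big)$$ with natural domains. For densely defined $C_{\phi_1,\omega_1},C_{\phi_2,\omega_2}$ put $A=C_{\phi_1,\omega_1}^*C_{\phi_1,\omega_1}+C_{\phi_2,\omega_2}^*C_{\phi_2,\omega_2}$ (always positive self-adjoint) and $B=C_{\phi_1,\omega_1}C_{\phi_1,\omega_1}^*+C_{\phi_2,\omega_2}C_{\phi_2,\omega_2}^*$.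 For $0<p\le1$, the pair is spherically $p$-hyponormal if $B$ is self-adjoint, $\mathcal{D}(A^{p/2})\subseteq\mathcal{D}(B^{p/2})$, and $\|B^{p/2}f\|\le\|A^{p/2}f\|$ for all $f\in\mathcal{D}(A^{p/2})$ (powers via the spectral functional calculus). A real sequence $\{s_k\}_{k\in\mathbb{Z}_+}$ is a Stieltjes moment sequence if there is a positive Borel measure $\nu$ on $[0,\infty)$ with $s_k=\int_0^\infty t^k\,d\nu(t)$ for all $k\in\mathbb{Z}_+$. *)

(* Defs.v *)
From HB Require Import structures.
From mathcomp Require Import all_boot all_order all_algebra.
From mathcomp Require Import all_classical all_reals all_analysis.
From mathcomp Require Import complex.

Set Implicit Arguments.
Unset Strict Implicit.
Unset Printing Implicit Defensive.

Import Order.TTheory GRing.Theory Num.Theory.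
Import numFieldNormedType.Exports.

Local Open Scope classical_set_scope.
Local Open Scope ring_scope.

(** * The Hilbert space l^2(I) *)

Section l2.
Context {R : realType}.
Local Notation C := R[i].

Definition sqnorm {I : choiceType} (f : I -> C) : \bar R :=
  (\esum_(i in [set: I]) (Normc.normc (f i) ^+ 2)%:E)%E.

Definition l2 {I : choiceType} (f : I -> C) : Prop := (sqnorm f < +oo)%E.

(* Meaningful on [l2] only, since [fine +oo = 0]. *)
Definition norm2 {I : choiceType} (f : I -> C) : R := Num.sqrt (fine (sqnorm f)).

(* Sums of absolutely summable families: positive part minus negative part,
   separately for the real and the imaginary parts. *)
Definition rsum {I : choiceType} (F : I -> R) : R :=
  fine (\esum_(i in [set: I]) (EFin \o F)^\+ i)%E -
  fine (\esum_(i in [set: I]) (EFin \o F)^\- i)%E.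

Definition csum {I : choiceType} (F : I -> C) : C :=
  Complex (rsum (fun i => complex.Re (F i))) (rsum (fun i => complex.Im (F i))).

Definition inner {I : choiceType} (f g : I -> C) : C :=
  csum (fun i => f i * conjc (g i)).

(* a f + g, pointwise *)
Definition axpy {I : Type} (a : C) (f g : I -> C) : I -> C :=
  fun i => a * f i + g i.

End l2.

(** * Unbounded operators, represented by their graphs *)

Definition operator (R : realType) (I J : choiceType) : Type :=
  set ((I -> R[i]) * (J -> R[i])).

Section operators.
Context {R : realType}.
Local Notation C := R[i].

Definition dom {I J : choiceType} (T : operator R I J) : set (I -> C) :=
  [set f | exists g, T (f, g)].

Definition oadd {I J : choiceType} (S T : operator R I J) : operator R I J :=
  [set fg | exists g1 g2,
     [/\ S (fg.1, g1), T (fg.1, g2) & fg.2 = (fun j => g1 j + g2 j)]].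

Definition oscale {I J : choiceType} (a : R) (T : operator R I J) :
    operator R I J :=
  [set fg | exists2 g, T (fg.1, g) & fg.2 = (fun j => (a%:C)%C * g j)].

(* [ocomp S T] is the product S T: first T, then S. *)
Definition ocomp {I J K : choiceType} (S : operator R J K) (T : operator R I J) :
    operator R I K :=
  [set fg | exists2 h, T (fg.1, h) & S (h, fg.2)].

(* Single-valued exactly when [T] is densely defined. *)
Definition adjoint {I J : choiceType} (T : operator R I J) : operator R J I :=
  [set gh | [/\ l2 gh.1, l2 gh.2 &
     forall f k, T (f, k) -> inner k gh.1 = inner f gh.2]].

Definition densely_defined {I J : choiceType} (T : operator R I J) : Prop :=
  forall f, l2 f -> forall e : R, 0 < e ->
    exists g, [/\ dom T g, l2 g & norm2 (axpy (-1) g f) < e].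

Definition self_adjoint {I : choiceType} (T : operator R I I) : Prop :=
  densely_defined T /\ T = adjoint T.

(** ** Spectral functional calculus *)

(* A projection-valued measure [E] on the Borel sets of R; [mu f] is the
   scalar measure S |-> <E(S) f, f>.  An everywhere defined idempotent P with
   <P f, g> = <f, P g> is automatically linear and bounded, i.e. it is an
   orthogonal projection. *)
Definition spectral_measure {I : choiceType}
    (E : set (measurableTypeR R) -> (I -> C) -> (I -> C))
    (mu : (I -> C) -> {measure set (measurableTypeR R) -> \bar R}) : Prop :=
  [/\ forall S, measurable S ->
        [/\ forall f, l2 f -> l2 (E S f),
            forall f, l2 f -> E S (E S f) = E S f &
            forall f g, l2 f -> l2 g -> inner (E S f) g = inner f (E S g)],
      forall f, l2 f -> E setT f = f,
      forall S T, measurable S -> measurable T ->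
        forall f, l2 f -> E (S `&` T) f = E S (E T f) &
      forall f S, l2 f -> measurable S ->
        mu f S = (complex.Re (inner (E S f) f))%:E].

Definition spectral_domain {I : choiceType}
    (mu : (I -> C) -> {measure set (measurableTypeR R) -> \bar R})
    (phi : R -> R) : set (I -> C) :=
  [set f | l2 f /\ (\int[mu f]_t ((phi t) ^+ 2)%:E < +oo)%E].

(* The operator T = \int phi dE: its domain is [spectral_domain], and T f is
   determined by <T f, h> = \int phi d<E f, h> for h in the (dense) domain,
   where the complex measure <E f, h> is expanded by polarization as
   1/4 \sum_(k < 4) i^k mu (f + i^k h). *)
Definition spectral_integral {I : choiceType}
    (mu : (I -> C) -> {measure set (measurableTypeR R) -> \bar R})
    (phi : R -> R) : operator R I I :=
  [set fg | [/\ spectral_domain mu phi fg.1, l2 fg.2 &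
     forall h, spectral_domain mu phi h ->
       inner fg.2 h = 4^-1 *
         \sum_(k < 4) ('i%C ^+ k *
           (\int[mu (axpy ('i%C ^+ k) h fg.1)]_t phi t)%:C%C)]].

(* A^s = \int t^s dE, where E is the spectral measure of A = \int t dE, for A
   positive self-adjoint and 0 < s.  E is then carried by [0, +oo[, so the
   values of [powR] at negative arguments do not matter. *)
Definition opow {I : choiceType} (A : operator R I I) (s : R) :
    operator R I I :=
  xget set0 [set T | exists E mu,
    [/\ spectral_measure E mu, A = spectral_integral mu id &
        T = spectral_integral mu (fun t => t `^ s)]].

(** ** Polar decomposition *)

Definition ker {I J : choiceType} (T : operator R I J) : set (I -> C) :=
  [set f | T (f, fun=> 0)].

Definition oabs {I J : choiceType} (T : operator R I J) : operator R I I :=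
  opow (ocomp (adjoint T) T) 2^-1.

Definition partial_isometry {I J : choiceType} (U : operator R I J) : Prop :=
  [/\ dom U = l2,
      forall f g g', U (f, g) -> U (f, g') -> g = g',
      forall a f g f' g', U (f, g) -> U (f', g') -> U (axpy a f f', axpy a g g'),
      exists M : R, forall f g, U (f, g) -> l2 g /\ norm2 g <= M * norm2 f &
      forall f g, U (f, g) -> (forall k, ker U k -> inner f k = 0) ->
        norm2 g = norm2 f].

(* The factor U of the polar decomposition T = U |T|. *)
Definition polar_factor {I J : choiceType} (T : operator R I J) :
    operator R I J :=
  xget set0 [set U | [/\ partial_isometry U, ker U = ker (oabs T) &
                        T = ocomp U (oabs T)]].

(** ** Pairs of operators *)

(* l^2(J) (+) l^2(K) is l^2(J + K). *)
Definition column {I J K : choiceType} (S : operator R I J)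
    (T : operator R I K) : operator R I (J + K)%type :=
  [set fg : (I -> C) * (J + K -> C) |
     S (fg.1, fg.2 \o inl) /\ T (fg.1, fg.2 \o inr)].

Definition upper {I J K : choiceType} (U : operator R I (J + K)%type) :
    operator R I J := [set fg | exists2 g, U (fg.1, g) & fg.2 = g \o inl].

Definition lower {I J K : choiceType} (U : operator R I (J + K)%type) :
    operator R I K := [set fg | exists2 g, U (fg.1, g) & fg.2 = g \o inr].

Definition opair (I : choiceType) : Type := (operator R I I * operator R I I)%type.

Definition pcolumn {I : choiceType} (T : opair I) : operator R I (I + I)%type :=
  column T.1 T.2.

(* Pairs are identified with their column operators. *)
Definition same_pair {I : choiceType} (S T : opair I) : Prop :=
  pcolumn S = pcolumn T.

Definition spherical_mean_transform {I : choiceType} (lam : R) (T : opair I) :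
    opair I :=
  let P := oabs (pcolumn T) in
  let U1 := upper (polar_factor (pcolumn T)) in
  let U2 := lower (polar_factor (pcolumn T)) in
  (oadd (oscale lam (ocomp U1 P)) (oscale (1 - lam) (ocomp P U1)),
   oadd (oscale lam (ocomp U2 P)) (oscale (1 - lam) (ocomp P U2))).

(** ** Weighted composition operators and spherical p-hyponormality *)

Definition wcomp {I : choiceType} (phi : I -> I) (omega : I -> C) :
    operator R I I :=
  [set fg | [/\ l2 fg.1, l2 fg.2 &
                fg.2 = (fun x => omega x * fg.1 (phi x))]].

Definition sph_hyponormal_components {I : choiceType} (p : R)
    (C1 C2 : operator R I I) : Prop :=
  let A := oadd (ocomp (adjoint C1) C1) (ocomp (adjoint C2) C2) in
  let B := oadd (ocomp C1 (adjoint C1)) (ocomp C2 (adjoint C2)) in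
  [/\ self_adjoint B,
      dom (opow A (p / 2)) `<=` dom (opow B (p / 2)) &
      forall f g h, opow A (p / 2) (f, g) -> opow B (p / 2) (f, h) ->
        norm2 h <= norm2 g].

(* Spherical p-hyponormality is a notion for pairs of densely defined weighted
   composition operators.  Since pairs are identified with column operators, a
   pair [T] has it when the pair of weighted composition operators with the same
   column operator has it; such operators are determined by the column operator,
   their values on the unit vectors e_x. *)
Definition sph_hyponormal {I : choiceType} (p : R) (T : opair I) : Prop :=
  exists (phi1 phi2 : I -> I) (w1 w2 : I -> C),
    [/\ same_pair T (wcomp phi1 w1, wcomp phi2 w2),
        densely_defined (wcomp phi1 w1), densely_defined (wcomp phi2 w2) &
        sph_hyponormal_components p (wcomp phi1 w1) (wcomp phi2 w2)].

End operators.

(** * Two-variable weighted shifts *)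

Section shifts.
Context {R : realType}.
Local Notation X := (nat * nat)%type.
Implicit Types a b : X -> R.

(* [n.-1] is 0 for [n = 0]. *)
Definition phi1 (x : X) : X := (x.1.-1, x.2).
Definition phi2 (x : X) : X := (x.1, x.2.-1).

Definition omega1 a (x : X) : R[i] :=
  if x.1 is n.+1 then ((a (n, x.2))%:C)%C else 0.
Definition omega2 b (x : X) : R[i] :=
  if x.2 is m.+1 then ((b (x.1, m))%:C)%C else 0.

Definition wshift a b : opair X :=
  (wcomp phi1 (omega1 a), wcomp phi2 (omega2 b)).

Definition sqsum a b (x : X) : R := a x ^+ 2 + b x ^+ 2.

(* The factors multiplying alpha_(n,m) and beta_(n,m) in the weights of the
   mean transform. *)
Definition mean_coef1 (lam : R) a b (x : X) : R :=
  (1 - lam) * Num.sqrt (sqsum a b (x.1.+1, x.2) / sqsum a b x) + lam.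
Definition mean_coef2 (lam : R) a b (x : X) : R :=
  (1 - lam) * Num.sqrt (sqsum a b (x.1, x.2.+1) / sqsum a b x) + lam.

Definition mean_weight1 (lam : R) a b (x : X) : R := mean_coef1 lam a b x * a x.
Definition mean_weight2 (lam : R) a b (x : X) : R := mean_coef2 lam a b x * b x.

Definition mean_density a b (x : X) : R :=
  1 + a x ^+ 2 + b x ^+ 2 +
  (a x ^+ 2 * sqsum a b (x.1.+1, x.2) + b x ^+ 2 * sqsum a b (x.1, x.2.+1)) /
  (a x ^+ 2 + b x ^+ 2).

(* The values at (n-1, m) and at (n, m-1), read as 0 off the quadrant. *)
Definition west (u : X -> R) (x : X) : R :=
  if x.1 is n.+1 then u (n, x.2) else 0.
Definition south (u : X -> R) (x : X) : R :=
  if x.2 is m.+1 then u (x.1, m) else 0.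

(* Only the restriction of [nu] to [0, +oo[ matters. *)
Definition stieltjes_moment (s : nat -> R) : Prop :=
  exists nu : {measure set (measurableTypeR R) -> \bar R},
    forall k : nat, ((s k)%:E = \int[nu]_(t in `[0%R, +oo[) (t ^+ k)%:E)%E.

End shifts.

(* Main.v *)
Require Import Defs.
From HB Require Import structures.
From mathcomp Require Import all_boot all_order all_algebra.
From mathcomp Require Import all_classical all_reals all_analysis.
From mathcomp Require Import complex measurable_realfun.
From mathcomp Require Import ring lra.

(** Only diagonal operators and weighted injections of the index set occur in
    the statement, so all the operator theory becomes arithmetic of weights.
    Put s(x) = alpha(x)^2 + beta(x)^2.

    Hyponormality.  A weighted shift sends e_x to a multiple of e_y, where y is
    the next index, so for the two components the sum A of the C_i^* C_i is the
    diagonal operator with entries s(x), and the sum B of the C_i C_i^* is the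
    diagonal operator with entries alpha(x - e_1)^2 + beta(x - e_2)^2
    ([oadd_sqr_diag]).  Powers of nonnegative diagonal operators are taken
    entrywise ([opow_diag]), and comparing two of them on vectors is comparing
    their entries ([diag_pow_le]).  Since t |-> t^(p/2) is increasing, the
    outcome does not depend on p ([sph_components_wpush]).  A pair of weighted
    composition operators is determined by its values on the e_x, so the choice
    of a representing pair is harmless ([wcomp_pair_determined]).

    Functional calculus.  A power is defined through an arbitrary spectral
    measure E of A = \int t dE, so E has to be shown unique when A is diagonal
    with entries d_i.  Let m be the measure S |-> <E(S) e_i, e_i>.  Testing
    A e_i = d_i e_i against E(S) e_i and polarizing gives
    \int_S t dm = d_i m(S) for every Borel set S ([Rintegral_basis]).  With S
    on one side of d_i this forces m(S) = 0, so m is carried by the point d_i,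
    which determines E(S) e_i ([spectral_basis]) and, by symmetry of the
    projections, E(S) ([spectral_diag_projE]).

    Mean transform.  The column operator T has T^* T diagonal with entries s,
    so |T| is diagonal with entries sqrt(s) ([oabs_pcolumn]).  The identity
    T = U |T| fixes U on finitely supported vectors, and a bounded linear
    operator is determined by them ([polar_factor_pcolumn]).  Hence
    U_1 |T| and |T| U_1 are both weighted shifts in the first direction, with
    weights alpha and sqrt(s(x + e_1) / s(x)) alpha; all weights are positive,
    so their convex combination has the intersection of the two domains as its
    domain ([mean_weight_l2], [dom_mean]).  Parts (iii) and (i) are then the
    same criterion for two pairs of weight sequences.

    Part (iv).  By (a) the coefficients multiplying alpha and beta coincide and
    depend on n + m only; by (b) and the log-convexity of moment sequences
    ([stieltjes_log_convex]) they increase with n + m.  So passing to the mean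
    transform multiplies the left side of the criterion by at most the factor
    by which it multiplies the right side ([mean_preserves_hyponormal]). *)

Set Implicit Arguments.
Unset Strict Implicit.
Unset Printing Implicit Defensive.

Import Order.TTheory GRing.Theory Num.Theory.
Import numFieldNormedType.Exports.

Local Open Scope classical_set_scope.
Local Open Scope ring_scope.

(** * Absolutely summable real families *)

Section real_sums.
Context {R : realType}.
Implicit Types I J : choiceType.

Definition rsummable {I} (F : I -> R) : Prop :=
  summable [set: I] (EFin \o F).

Lemma esum_eq0_off I (D : set I) (F : I -> \bar R) :
  (forall i, ~ D i -> F i = 0%E) ->
  (\esum_(i in [set: I]) F i = \esum_(i in D) F i)%E.
Proof.
move=> F0; rewrite [RHS]esum_mkcond; apply: eq_esum => i _.
by case: ifPn => // /negP; rewrite inE => /F0 ->.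
Qed.

Lemma esum_inj I J (s : I -> J) (F : J -> \bar R) : injective s ->
  (forall j, ~ range s j -> F j = 0%E) ->
  (\esum_(j in [set: J]) F j = \esum_(i in [set: I]) F (s i))%E.
Proof.
move=> s_inj /esum_eq0_off ->; rewrite (esum_image [set: I] s)//.
by move=> i j _ _; exact: s_inj.
Qed.

Lemma rsummable_ge0 I (F : I -> R) : (forall i, 0 <= F i) ->
  rsummable F <-> (\esum_(i in [set: I]) (F i)%:E < +oo)%E.
Proof.
move=> F0; rewrite /rsummable /summable.
suff -> : (\esum_(i in [set: I]) `|(EFin \o F) i| =
  \esum_(i in [set: I]) (F i)%:E)%E by [].
by apply: eq_esum => i _ /=; rewrite ger0_norm.
Qed.

Lemma rsummable_le I (F G : I -> R) :
  (forall i, `|F i| <= G i) -> rsummable G -> rsummable F.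
Proof.
move=> FG; apply: le_lt_trans; apply: le_esum => i _ /=.
by rewrite lee_fin (le_trans (FG i))// ler_norm.
Qed.

Lemma rsummableD I (F G : I -> R) :
  rsummable F -> rsummable G -> rsummable (fun i => F i + G i).
Proof. by move=> HF HG; have := summableD HF HG; apply. Qed.

Lemma rsummableN I (F : I -> R) : rsummable F -> rsummable (fun i => - F i).
Proof. by rewrite /rsummable summableN. Qed.

Lemma esumZ_le I (c : R) (F : I -> R) : 0 <= c ->
  (\esum_(i in [set: I]) (c * F i)%:E <=
   c%:E * \esum_(i in [set: I]) (F i)%:E)%E.
Proof.
move=> c0; apply: ge_ereal_sup => _ [X [finX _] <-].
rewrite fsbig_finite//= sumEFin -mulr_sumr EFinM lee_wpmul2l//.
by apply: esum_ge; exists X => //; rewrite fsbig_finite//= sumEFin.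
Qed.

Lemma esumZ I (c : R) (F : I -> R) : 0 <= c ->
  (\esum_(i in [set: I]) (c * F i)%:E =
   c%:E * \esum_(i in [set: I]) (F i)%:E)%E.
Proof.
rewrite le_eqVlt => /predU1P[<-|c0].
  by rewrite mul0e esum1// => i _; rewrite mul0r.
apply/eqP; rewrite eq_le (esumZ_le _ (ltW c0)) /=.
have := @esumZ_le _ c^-1 (fun i => c * F i).
rewrite invr_ge0 => /(_ (ltW c0)); under eq_esum do rewrite mulKf ?gt_eqF//.
move=> le_esum; have c0' : (0 <= c%:E)%E by rewrite lee_fin ltW.
  apply: (le_trans (lee_wpmul2l c0' le_esum)).
by rewrite muleA -EFinM divff ?gt_eqF// mul1e.
Qed.

Lemma rsummableZ I (c : R) (F : I -> R) :
  rsummable F -> rsummable (fun i => c * F i).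
Proof.
move=> HF; rewrite /rsummable /summable.
rewrite [X in (X < _)%E](_ : _ =
  \esum_(i in [set: I]) (`|c| * `|F i|)%:E)%E; last first.
  by apply: eq_esum => i _ /=; rewrite normrM.
by rewrite esumZ// lte_mul_pinfty.
Qed.

Lemma rsumE I (F : I -> R) :
  rsum F = fine (\esum_(i in [set: I]) (Num.max (F i) 0)%:E)%E -
           fine (\esum_(i in [set: I]) (Num.max (- F i) 0)%:E)%E.
Proof.
rewrite /rsum; congr (fine _ - fine _); apply: eq_esum => i _.
  by rewrite funeposE /= EFin_max.
by rewrite funenegE /= EFin_max.
Qed.

Lemma rsum_ge0E I (F : I -> R) : (forall i, 0 <= F i) ->
  rsum F = fine (\esum_(i in [set: I]) (F i)%:E)%E.
Proof.
move=> F0; rewrite rsumE [X in _ - fine X]esum1 ?subr0; last first.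
  by move=> i _; congr EFin; apply/max_idPr; rewrite oppr_le0.
by congr fine; apply: eq_esum => i _; congr EFin; exact/max_idPl.
Qed.

Lemma rsummable_esum I (F : I -> R) : (forall i, 0 <= F i) -> rsummable F ->
  (\esum_(i in [set: I]) (F i)%:E = (rsum F)%:E)%E.
Proof.
move=> F0 HF; rewrite rsum_ge0E// fineK// ge0_fin_numE.
  exact: (rsummable_ge0 F0).1.
by apply: esum_ge0 => i _; rewrite lee_fin.
Qed.

(** [rsum] is defined by the positive and negative parts of the family; any
    other decomposition as a difference of summable nonnegative families gives
    the same value, and this makes [rsum] additive. *)
Lemma rsumB_ge0 I (F G : I -> R) : (forall i, 0 <= F i) -> (forall i, 0 <= G i) ->
  rsummable F -> rsummable G -> rsum (fun i => F i - G i) = rsum F - rsum G.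
Proof.
move=> F0 G0 HF HG.
have := esumB HF HG (fun i _ => F0 i) (fun i _ => G0 i).
rewrite [X in (_ = X)%E -> _](_ : _ = (rsum F - rsum G)%:E); last first.
  by rewrite EFinB -!rsummable_esum.
have HFG : summable [set: I] (EFin \o (fun i => F i - G i)).
  exact: rsummableD HF (rsummableN HG).
move=> /(congr1 fine) /= <-; rewrite /rsum fineB//.
- have := summable_funepos HFG; rewrite /summable => Hp.
  rewrite ge0_fin_numE ?esum_ge0//; apply: le_lt_trans Hp.
  by apply: le_esum => i _; exact: lee_abs.
- have := summable_funeneg HFG; rewrite /summable => Hp.
  rewrite ge0_fin_numE ?esum_ge0//; apply: le_lt_trans Hp.
  by apply: le_esum => i _; exact: lee_abs.
Qed.

Lemma rsum_ge0D I (F G : I -> R) : (forall i, 0 <= F i) -> (forall i, 0 <= G i) ->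
  rsummable F -> rsummable G -> rsum (fun i => F i + G i) = rsum F + rsum G.
Proof.
move=> F0 G0 HF HG; apply: EFin_inj.
rewrite [RHS]EFinD -(rsummable_esum F0 HF) -(rsummable_esum G0 HG) -esumD.
- rewrite -rsummable_esum//; first by move=> i; rewrite addr_ge0.
  exact: rsummableD.
- by move=> i _; rewrite lee_fin.
- by move=> i _; rewrite lee_fin.
Qed.

Lemma max0_subr (x : R) : x = Num.max x 0 - Num.max (- x) 0.
Proof. by case: (lerP 0 x) => h; [rewrite max_r|rewrite max_l]; lra. Qed.

Lemma rsummable_pos I (F : I -> R) : rsummable F ->
  rsummable (fun i => Num.max (F i) 0).
Proof.
move=> HF; apply: (@rsummable_le _ _ (fun i => `|F i|)) => [i|].
  by rewrite ger0_norm ?le_max ?lexx ?orbT// ge_max normr_ge0 ler_norm.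
by apply/rsummable_ge0.
Qed.

Lemma rsum_posneg I (F : I -> R) : rsummable F ->
  rsum F = rsum (fun i => Num.max (F i) 0) - rsum (fun i => Num.max (- F i) 0).
Proof.
move=> HF; rewrite -rsumB_ge0//.
- by congr rsum; apply/funext => i; exact: max0_subr.
- by move=> i; rewrite le_max lexx orbT.
- by move=> i; rewrite le_max lexx orbT.
- exact: rsummable_pos.
- exact/rsummable_pos/rsummableN.
Qed.

Lemma rsum_ge0DB I (F G F' G' : I -> R) :
  (forall i, 0 <= F i) -> (forall i, 0 <= G i) ->
  (forall i, 0 <= F' i) -> (forall i, 0 <= G' i) ->
  rsummable F -> rsummable G -> rsummable F' -> rsummable G' ->
  rsum (fun i => (F i - G i) + (F' i - G' i)) =
  (rsum F - rsum G) + (rsum F' - rsum G').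
Proof.
move=> F0 G0 F0' G0' HF HG HF' HG'.
rewrite [LHS](_ : _ = rsum (fun i => (F i + F' i) - (G i + G' i))); last first.
  by congr rsum; apply/funext => i; ring.
rewrite rsumB_ge0; first by rewrite !rsum_ge0D//; ring.
all: try by move=> i; rewrite addr_ge0.
all: exact: rsummableD.
Qed.

Lemma rsumD I (F G : I -> R) : rsummable F -> rsummable G ->
  rsum (fun i => F i + G i) = rsum F + rsum G.
Proof.
move=> HF HG; rewrite (rsum_posneg HF) (rsum_posneg HG) -rsum_ge0DB.
- by congr rsum; apply/funext => i; rewrite -!max0_subr.
all: try by move=> i; rewrite le_max lexx orbT.
all: first [exact: rsummable_pos | exact/rsummable_pos/rsummableN].
Qed.

Lemma rsumN I (F : I -> R) : rsummable F -> rsum (fun i => - F i) = - rsum F.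
Proof.
move=> HF; apply/eqP; rewrite -addr_eq0 -rsumD//; last exact: rsummableN.
rewrite /rsum -[X in _ == X](subrr (0 : R)); apply/eqP; congr (_ - _).
  by rewrite esum1// => i _; rewrite funeposE /= addNr maxxx.
by rewrite esum1// => i _; rewrite funenegE /= addNr oppr0 maxxx.
Qed.

Lemma rsumZ I (c : R) (F : I -> R) : rsummable F ->
  rsum (fun i => c * F i) = c * rsum F.
Proof.
wlog c0 : c / 0 <= c => [hw|HF].
  case: (leP 0 c) => [/hw //|c0 HF].
  have := hw (- c); rewrite oppr_ge0 ltW// => /(_ erefl HF).
  move=> /(congr1 (@GRing.opp _)); rewrite -rsumN; last exact: rsummableZ.
  by rewrite mulNr opprK => <-; congr rsum; apply/funext => i; ring.
have Z0 (G : I -> R) : (forall i, 0 <= G i) -> rsummable G ->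
    rsum (fun i => c * G i) = c * rsum G.
  move=> G0 HG; apply: EFin_inj; rewrite EFinM -!rsummable_esum ?esumZ//.
    by move=> i; rewrite mulr_ge0.
  exact: rsummableZ.
have HP := rsummable_pos HF; have HN := rsummable_pos (rsummableN HF).
have max0 (x : R) : 0 <= Num.max x 0 by rewrite le_max lexx orbT.
rewrite (rsum_posneg HF) mulrBr.
rewrite -(Z0 _ (fun=> max0 _) HP) -(Z0 _ (fun=> max0 _) HN).
rewrite -(rsumB_ge0 _ _ (rsummableZ c HP) (rsummableZ c HN)).
- by congr rsum; apply/funext => i; rewrite -mulrBr -max0_subr.
- by move=> i; rewrite mulr_ge0.
- by move=> i; rewrite mulr_ge0.
Qed.

Lemma rsum_inj I J (s : I -> J) (F : J -> R) : injective s ->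
  (forall j, ~ range s j -> F j = 0) -> rsum F = rsum (F \o s).
Proof.
move=> s_inj F0; rewrite !rsumE.
congr (fine _ - fine _); apply: (esum_inj s_inj) => j /F0 ->.
  by rewrite maxxx.
by rewrite oppr0 maxxx.
Qed.

Lemma rsum_single I (i : I) (F : I -> R) :
  (forall j, j != i -> F j = 0) -> rsum F = F i.
Proof.
move=> F0; rewrite (@rsum_inj unit I (fun=> i)); last 2 first.
- by move=> [] [].
- by move=> j ji; apply: F0; apply/eqP => jE; apply: ji; exists tt.
have Tt : [set: unit] = [set tt] by apply/seteqP; split=> -[].
rewrite rsumE !Tt !esum_set1 ?lee_fin ?le_max ?lexx ?orbT//=.
by rewrite -max0_subr.
Qed.

Lemma esum_sumtype I J (F : I + J -> \bar R) : (forall k, 0 <= F k)%E ->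
  (\esum_(k in [set: I + J]) F k =
   \esum_(i in [set: I]) F (inl i) + \esum_(j in [set: J]) F (inr j))%E.
Proof.
move=> F0; rewrite (esumID (range (@inl I J))); last by move=> *; exact: F0.
rewrite setTI (esum_image [set: I] inl); last by move=> ? ? _ _ [].
congr (_ + _)%E; rewrite -(esum_image [set: J] inr); last by move=> ? ? _ _ [].
congr esum; apply/seteqP; split => -[k|k] /=.
- by case=> _ /(_ (ex_intro2 _ _ k Logic.I erefl)).
- by move=> _; exists k.
- by case.
- by move=> _; split=> //; case.
Qed.

Lemma rsum_sumtype I J (F : I + J -> R) : rsummable F ->
  rsum F = rsum (F \o inl) + rsum (F \o inr).
Proof.
move=> HF.
pose Fl k := if k is inl _ then F k else 0.
pose Fr k := if k is inr _ then F k else 0.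
have -> : F = (fun k => Fl k + Fr k).
  by apply/funext => -[k|k]; rewrite /Fl /Fr ?addr0 ?add0r.
rewrite rsumD; last 2 first.
- by apply: rsummable_le ((rsummable_ge0 (fun i => normr_ge0 (F i))).2 HF);
    case=> k /=; rewrite ?normr0.
- by apply: rsummable_le ((rsummable_ge0 (fun i => normr_ge0 (F i))).2 HF);
    case=> k /=; rewrite ?normr0.
rewrite (@rsum_inj _ _ (@inl I J)); last 2 first.
- by move=> ? ? [].
- by case=> // k /(_ (ex_intro2 _ _ k Logic.I erefl)).
rewrite (@rsum_inj _ _ (@inr I J)); last 2 first.
- by move=> ? ? [].
- by case=> // k /(_ (ex_intro2 _ _ k Logic.I erefl)).
by congr (_ + _); congr rsum; apply/funext => k /=; rewrite ?addr0 ?add0r.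
Qed.

Lemma rsummable_finite I (D : set I) (F : I -> R) : finite_set D ->
  (forall i, ~ D i -> F i = 0) -> rsummable F.
Proof.
move=> finD F0; rewrite /rsummable /summable.
have := @esum_eq0_off _ D (fun i => `|F i|%:E).
rewrite /= => -> => [|i /F0 ->]; last by rewrite normr0.
by rewrite esum_fset// fsbig_finite//= sumEFin ltry.
Qed.

Lemma rsum_ge0 I (F : I -> R) : (forall i, 0 <= F i) -> 0 <= rsum F.
Proof.
move=> F0; rewrite rsum_ge0E//; apply: fine_ge0.
by apply: esum_ge0 => i _; rewrite lee_fin.
Qed.

Lemma rsum_le I (F G : I -> R) : (forall i, F i <= G i) ->
  rsummable F -> rsummable G -> rsum F <= rsum G.
Proof.
move=> FG HF HG; rewrite -subr_ge0 -rsumN// -rsumD//; last exact: rsummableN.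
by apply: rsum_ge0 => i; rewrite subr_ge0.
Qed.

End real_sums.

(** * Complex sums and square-summable families *)

Section hilbert.
Context {R : realType}.
Local Notation C := R[i].
Implicit Types I J : choiceType.

Definition nsq (z : C) : R := complex.Re z ^+ 2 + complex.Im z ^+ 2.

Lemma normc_sqr (z : C) : Normc.normc z ^+ 2 = nsq z.
Proof. by case: z => a b; rewrite /nsq /= sqr_sqrtr// addr_ge0// sqr_ge0. Qed.

Lemma nsq_ge0 z : 0 <= nsq z.
Proof. by rewrite addr_ge0// sqr_ge0. Qed.

Lemma nsq0 : nsq 0 = 0.
Proof. by rewrite /nsq /= expr0n addr0. Qed.

Lemma nsq_eq0 z : nsq z = 0 -> z = 0.
Proof.
case: z => a b /eqP; rewrite /nsq /= paddr_eq0 ?sqr_ge0// !sqrf_eq0.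
by move=> /andP[/eqP -> /eqP ->].
Qed.

Lemma nsqM z w : nsq (z * w) = nsq z * nsq w.
Proof. by case: z w => a b [c d]; rewrite /nsq /=; ring. Qed.

Lemma nsqr (a : R) : nsq (a%:C)%C = a ^+ 2.
Proof. by rewrite /nsq /= expr0n addr0. Qed.

Lemma nsqN z : nsq (- z) = nsq z.
Proof. by case: z => a b; rewrite /nsq /= !sqrrN. Qed.

Lemma nsqD_le z w : nsq (z + w) <= 2 * nsq z + 2 * nsq w.
Proof.
case: z w => a b [c d]; rewrite /nsq /= -subr_ge0.
rewrite [leRHS](_ : _ = (a - c) ^+ 2 + (b - d) ^+ 2); last by ring.
by rewrite addr_ge0// sqr_ge0.
Qed.

Lemma nsq_conj z : z * conjc z = ((nsq z)%:C)%C.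
Proof. by case: z => a b; rewrite /nsq /=; simpc; congr Complex; ring. Qed.

Lemma conjc_mul_conj (z w : C) : conjc (z * conjc w) = w * conjc z.
Proof. by case: z w => a b [c d]; simpc; congr Complex; ring. Qed.

Lemma conjcD (z w : C) : conjc (z + w) = conjc z + conjc w.
Proof. by case: z w => a b [c d] /=; rewrite opprD. Qed.

Lemma conjcM (z w : C) : conjc (z * w) = conjc z * conjc w.
Proof. by case: z w => a b [c d]; simpc; congr Complex; ring. Qed.

Lemma complex_ext (z w : C) : complex.Re z = complex.Re w ->
  complex.Im z = complex.Im w -> z = w.
Proof. by case: z w => a b [c d] /= -> ->. Qed.

Lemma ReD (z w : C) : complex.Re (z + w) = complex.Re z + complex.Re w.
Proof. by case: z w => a b [c d]. Qed.

Lemma ImD (z w : C) : complex.Im (z + w) = complex.Im z + complex.Im w.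
Proof. by case: z w => a b [c d]. Qed.

Lemma ReM (z w : C) : complex.Re (z * w) =
  complex.Re z * complex.Re w + (- complex.Im z) * complex.Im w.
Proof. by case: z w => a b [c d]; rewrite mulNr. Qed.

Lemma ImM (z w : C) : complex.Im (z * w) =
  complex.Re z * complex.Im w + complex.Im z * complex.Re w.
Proof. by case: z w => a b [c d]. Qed.

Definition csummable I (F : I -> C) : Prop :=
  rsummable (fun i => complex.Re (F i)) /\ rsummable (fun i => complex.Im (F i)).

Lemma csummableD I (F G : I -> C) :
  csummable F -> csummable G -> csummable (fun i => F i + G i).
Proof.
move=> [Fr Fi] [Gr Gi]; split.
  have -> : (fun i => complex.Re (F i + G i)) =
    (fun i => complex.Re (F i) + complex.Re (G i)) by apply/funext => i; exact: ReD.
  exact: (rsummableD Fr Gr).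
have -> : (fun i => complex.Im (F i + G i)) =
  (fun i => complex.Im (F i) + complex.Im (G i)) by apply/funext => i; exact: ImD.
exact: (rsummableD Fi Gi).
Qed.

Lemma csumD I (F G : I -> C) : csummable F -> csummable G ->
  csum (fun i => F i + G i) = csum F + csum G.
Proof.
move=> [Fr Fi] [Gr Gi]; rewrite /csum; apply: complex_ext => /=.
  by rewrite -rsumD//; congr rsum; apply/funext => i; exact: ReD.
by rewrite -rsumD//; congr rsum; apply/funext => i; exact: ImD.
Qed.

Lemma csummableZ I (c : C) (F : I -> C) :
  csummable F -> csummable (fun i => c * F i).
Proof.
move=> [Fr Fi]; split.
  have -> : (fun i => complex.Re (c * F i)) = (fun i =>
     complex.Re c * complex.Re (F i) + (- complex.Im c) * complex.Im (F i)).
    by apply/funext => i; exact: ReM.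
  by apply: rsummableD; apply: rsummableZ.
have -> : (fun i => complex.Im (c * F i)) = (fun i =>
   complex.Re c * complex.Im (F i) + complex.Im c * complex.Re (F i)).
  by apply/funext => i; exact: ImM.
by apply: rsummableD; apply: rsummableZ.
Qed.

Lemma csumZ I (c : C) (F : I -> C) : csummable F ->
  csum (fun i => c * F i) = c * csum F.
Proof.
move=> [Fr Fi]; rewrite /csum; apply: complex_ext.
  rewrite ReM -(rsumZ (complex.Re c) Fr) -(rsumZ (- complex.Im c) Fi).
  rewrite -(rsumD (rsummableZ _ Fr) (rsummableZ _ Fi)).
  by congr rsum; apply/funext => i; exact: ReM.
rewrite ImM -(rsumZ (complex.Re c) Fi) -(rsumZ (complex.Im c) Fr).
rewrite -(rsumD (rsummableZ _ Fi) (rsummableZ _ Fr)).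
by congr rsum; apply/funext => i; exact: ImM.
Qed.

Lemma csum_conj I (F : I -> C) : csummable F ->
  csum (fun i => conjc (F i)) = conjc (csum F).
Proof.
move=> [Fr Fi]; rewrite /csum; apply: complex_ext => /=.
  by congr rsum; apply/funext => i; case: (F i).
by rewrite -(rsumN Fi); congr rsum; apply/funext => i; case: (F i).
Qed.

Lemma csum_real I (F : I -> R) : csum (fun i => ((F i)%:C)%C) = ((rsum F)%:C)%C.
Proof.
rewrite /csum; congr Complex; rewrite rsum_ge0E//.
by rewrite (_ : esum _ _ = 0%E)// esum1.
Qed.

Lemma csummable_sum I (n : nat) (F : nat -> I -> C) :
  (forall k, csummable (F k)) -> csummable (fun i => \sum_(k < n) F k i).
Proof.
move=> sF; elim: n => [|n IHn].
  rewrite (_ : (fun i => _) = fun=> 0); last first.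
    by apply/funext => i; rewrite big_ord0.
  by split; apply: (@rsummable_finite _ _ set0).
rewrite (_ : (fun i => _) = (fun i => \sum_(k < n) F k i + F n i)); last first.
  by apply/funext => i; rewrite big_ord_recr.
exact: (csummableD IHn (sF n)).
Qed.

Lemma csum_sum I (n : nat) (F : nat -> I -> C) : (forall k, csummable (F k)) ->
  csum (fun i => \sum_(k < n) F k i) = \sum_(k < n) csum (F k).
Proof.
move=> sF; elim: n => [|n IHn].
  rewrite big_ord0 (_ : (fun i => _) = fun=> ((0 : R)%:C)%C); last first.
    by apply/funext => i; rewrite big_ord0.
  by rewrite csum_real rsum_ge0E// esum1.
rewrite big_ord_recr /= -IHn -(csumD (csummable_sum n sF) (sF n)).
by congr csum; apply/funext => i; rewrite big_ord_recr.
Qed.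

Lemma csum_inj I J (s : I -> J) (F : J -> C) : injective s ->
  (forall j, ~ range s j -> F j = 0) -> csum F = csum (F \o s).
Proof.
move=> s_inj F0; rewrite /csum.
by congr Complex; rewrite (rsum_inj s_inj)// => j /F0 ->.
Qed.

Lemma csum_sumtype I J (F : I + J -> C) : csummable F ->
  csum F = csum (F \o inl) + csum (F \o inr).
Proof.
by move=> [Fr Fi]; rewrite /csum (rsum_sumtype Fr) (rsum_sumtype Fi).
Qed.

Lemma csum_single I (i : I) (F : I -> C) :
  (forall j, j != i -> F j = 0) -> csum F = F i.
Proof.
move=> F0; rewrite /csum; apply: complex_ext => /=;
by rewrite (@rsum_single _ _ i)// => j /F0 ->.
Qed.

Lemma sqnormE I (f : I -> C) :
  sqnorm f = (\esum_(i in [set: I]) (nsq (f i))%:E)%E.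
Proof. by apply: eq_esum => i _; rewrite normc_sqr. Qed.

Lemma l2P I (f : I -> C) : l2 f <-> rsummable (fun i => nsq (f i)).
Proof.
by rewrite /l2 sqnormE; apply: iff_sym; apply: rsummable_ge0 => i; exact: nsq_ge0.
Qed.

Lemma norm2E I (f : I -> C) : norm2 f = Num.sqrt (rsum (fun i => nsq (f i))).
Proof. by rewrite /norm2 sqnormE rsum_ge0E// => i; exact: nsq_ge0. Qed.

Lemma norm2_sqr I (f : I -> C) : norm2 f ^+ 2 = rsum (fun i => nsq (f i)).
Proof.
by rewrite norm2E sqr_sqrtr//; apply: rsum_ge0 => i; exact: nsq_ge0.
Qed.

Lemma norm2_ge0 I (f : I -> C) : 0 <= norm2 f.
Proof. exact: sqrtr_ge0. Qed.

Lemma norm2_le I J (f : I -> C) (g : J -> C) :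
  rsum (fun i => nsq (f i)) <= rsum (fun j => nsq (g j)) -> norm2 f <= norm2 g.
Proof. by rewrite !norm2E; exact: ler_wsqrtr. Qed.

Lemma l2_le I (f : I -> C) (G : I -> R) :
  (forall i, nsq (f i) <= G i) -> rsummable G -> l2 f.
Proof.
by move=> fG HG; apply/l2P; apply: rsummable_le HG => i; rewrite ger0_norm ?nsq_ge0.
Qed.

Lemma l2_axpy I (a : C) (f g : I -> C) : l2 f -> l2 g -> l2 (axpy a f g).
Proof.
move=> /l2P lf /l2P lg.
apply: (l2_le _ (rsummableD (rsummableZ (2 * nsq a) lf) (rsummableZ (2) lg))).
by move=> i; rewrite /axpy; apply: le_trans (nsqD_le _ _) _; rewrite nsqM mulrA.
Qed.

Lemma l2D I (f g : I -> C) : l2 f -> l2 g -> l2 (fun i => f i + g i).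
Proof.
move=> lf lg; have := l2_axpy 1 lf lg; congr l2.
by apply/funext => i; rewrite /axpy mul1r.
Qed.

Lemma l2_finite I (D : set I) (f : I -> C) : finite_set D ->
  (forall i, ~ D i -> f i = 0) -> l2 f.
Proof.
move=> finD f0; apply/l2P; apply: (rsummable_finite finD) => i /f0 ->.
exact: nsq0.
Qed.

Lemma l2_0 I : @l2 R I (fun=> 0).
Proof. by apply: (@l2_finite _ set0). Qed.

Lemma l2_sumtype I J (f : I + J -> C) : l2 f <-> l2 (f \o inl) /\ l2 (f \o inr).
Proof.
rewrite /l2 !sqnormE esum_sumtype => [|k]; last by rewrite lee_fin nsq_ge0.
have p (K : choiceType) (g : K -> C) : (0 <= \esum_(i in [set: K]) (nsq (g i))%:E)%E.
  by apply: esum_ge0 => i _; rewrite lee_fin nsq_ge0.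
rewrite -!ge0_fin_numE ?adde_ge0//; try exact: p.
by rewrite fin_numD; split=> [/andP[]|[-> ->]].
Qed.

Lemma l2_comp I J (s : I -> J) (f : J -> C) : injective s -> l2 f -> l2 (f \o s).
Proof.
move=> s_inj; apply: le_lt_trans; rewrite !sqnormE.
rewrite -(@esum_image _ _ _ setT s (fun j => (nsq (f j))%:E)); last first.
  by move=> i j _ _; exact: s_inj.
rewrite [leLHS]esum_mkcond; apply: le_esum => j _.
by case: ifP => // _; rewrite lee_fin nsq_ge0.
Qed.

Lemma l2_inner I (f g : I -> C) : l2 f -> l2 g ->
  csummable (fun i => f i * conjc (g i)).
Proof.
move=> /l2P lf /l2P lg; have lfg := rsummableD lf lg.
have le_sqr (a b c d : R) : `|a * c + b * d| <= a ^+ 2 + b ^+ 2 + (c ^+ 2 + d ^+ 2).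
  have := sqr_ge0 (a - c); have := sqr_ge0 (b - d).
  have := sqr_ge0 (a + c); have := sqr_ge0 (b + d).
  have := sqr_ge0 a; have := sqr_ge0 b; have := sqr_ge0 c; have := sqr_ge0 d.
  by rewrite ler_norml => *; apply/andP; split; nra.
split; apply: rsummable_le lfg => i; case: (f i) (g i) => a b [c d]; rewrite /nsq /=.
  by have := le_sqr a b c d; rewrite mulrN opprK.
by have := le_sqr (- a) b d c; rewrite sqrrN mulNr mulrN [d ^+ 2 + _]addrC.
Qed.

Lemma inner_axpyl I (a : C) (f g h : I -> C) : l2 f -> l2 g -> l2 h ->
  inner (axpy a f g) h = a * inner f h + inner g h.
Proof.
move=> lf lg lh; rewrite /inner -csumZ; last exact: l2_inner.
rewrite -csumD; last 2 first.
- exact/csummableZ/l2_inner.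
- exact: l2_inner.
by congr csum; apply/funext => i; rewrite /axpy; ring.
Qed.

Lemma inner_conj I (f g : I -> C) : l2 f -> l2 g ->
  inner g f = conjc (inner f g).
Proof.
move=> lf lg; rewrite /inner -csum_conj; last exact: l2_inner.
by congr csum; apply/funext => i; rewrite conjc_mul_conj.
Qed.

Lemma inner_scalel I (a : C) (f g : I -> C) : l2 f -> l2 g ->
  inner (fun i => a * f i) g = a * inner f g.
Proof.
move=> lf lg; rewrite /inner -(csumZ a (l2_inner lf lg)).
by congr csum; apply/funext => i; rewrite mulrA.
Qed.

Lemma inner_axpyr I (a : C) (f g h : I -> C) : l2 f -> l2 g -> l2 h ->
  inner h (axpy a f g) = conjc a * inner h f + inner h g.
Proof.
move=> lf lg lh; rewrite inner_conj ?inner_axpyl//; last exact: l2_axpy.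
by rewrite conjcD conjcM -!inner_conj.
Qed.

Lemma inner_self I (f : I -> C) : inner f f = ((norm2 f ^+ 2)%:C)%C.
Proof.
rewrite norm2_sqr /inner -csum_real.
by congr csum; apply/funext => i; exact: nsq_conj.
Qed.

Lemma nsq_le_norm2 I (f : I -> C) i : l2 f -> nsq (f i) <= norm2 f ^+ 2.
Proof.
move=> /l2P lf; rewrite norm2_sqr.
pose F j := if j == i then nsq (f j) else 0.
have -> : nsq (f i) = F i by rewrite /F eqxx.
rewrite -(@rsum_single _ _ i F); last by move=> j; rewrite /F => /negPf ->.
apply: rsum_le => //.
  by move=> j; rewrite /F; case: ifP => // _; exact: nsq_ge0.
apply: (rsummable_finite (finite_set1 i)) => j /eqP.
by rewrite /F => /negPf ->.
Qed.

Lemma norm2_eq0 I (f : I -> C) : l2 f -> norm2 f ^+ 2 = 0 -> f = fun=> 0.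
Proof.
move=> lf f0; apply/funext => i; apply: nsq_eq0; apply/eqP.
by rewrite eq_le nsq_ge0 -f0 nsq_le_norm2.
Qed.

Definition basis I (i : I) : I -> C := fun j => (j == i)%:R.

Lemma l2_basis I (i : I) : l2 (basis i).
Proof.
by apply: (l2_finite (finite_set1 i)) => j /eqP/negPf; rewrite /basis => ->.
Qed.

Lemma inner_basisr I (f : I -> C) i : inner f (basis i) = f i.
Proof.
rewrite /inner (@csum_single _ i) /basis ?eqxx ?conjc1 ?mulr1//.
by move=> j /negPf ->; rewrite conjc0 mulr0.
Qed.

Lemma inner_basisl I (f : I -> C) i : inner (basis i) f = conjc (f i).
Proof.
rewrite /inner (@csum_single _ i) /basis ?eqxx ?mul1r//.
by move=> j /negPf ->; rewrite mul0r.
Qed.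

Definition trunc I (D : set I) (f : I -> C) : I -> C :=
  fun i => if i \in D then f i else 0.

Lemma trunc_off I (D : set I) (f : I -> C) i : ~ D i -> trunc D f i = 0.
Proof. by move=> Di; rewrite /trunc memNset. Qed.

Lemma l2_trunc I (D : set I) (f : I -> C) : l2 f -> l2 (trunc D f).
Proof.
move=> /l2P lf; apply: (l2_le _ lf) => i.
by rewrite /trunc; case: ifP => // _; rewrite nsq0 nsq_ge0.
Qed.

Lemma truncI I (D D' : set I) (f : I -> C) : trunc (D `&` D') f = trunc D (trunc D' f).
Proof. by apply/funext => i; rewrite /trunc in_setI; case: (i \in D). Qed.

Lemma truncT I (f : I -> C) : trunc setT f = f.
Proof. by apply/funext => i; rewrite /trunc in_setT. Qed.

Lemma inner_trunc I (D : set I) (f g : I -> C) : inner (trunc D f) g = inner f (trunc D g).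
Proof.
congr csum; apply/funext => i; rewrite /trunc.
by case: (i \in D); rewrite // mul0r conjc0 mulr0.
Qed.

Lemma inner_trunc_self I (D : set I) (f : I -> C) :
  inner (trunc D f) f = ((norm2 (trunc D f) ^+ 2)%:C)%C.
Proof. by rewrite -inner_self -inner_trunc -truncI setIid. Qed.

(** Finitely supported vectors are dense: the squared error of a truncation is
    the part of the norm series that it misses. *)
Lemma trunc_dense I (f : I -> C) (e : R) : l2 f -> 0 < e ->
  exists2 D, finite_set D & norm2 (axpy (-1) (trunc D f) f) < e.
Proof.
move=> lf e0; have f0 i : 0 <= nsq (f i) by exact: nsq_ge0.
have sf := (l2P f).1 lf; have fE := rsummable_esum f0 sf.
have e20 : 0 < e ^+ 2 by rewrite exprn_gt0.
have : ((rsum (fun i => nsq (f i)) - e ^+ 2)%:E <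
    \esum_(i in [set: I]) (nsq (f i))%:E)%E.
  by rewrite fE lte_fin ltrBlDr ltrDl.
move=> /ereal_sup_gt[_ [D [finD _] <-]].
rewrite -esum_fset// => [|i _]; last by rewrite lee_fin.
pose h i := nsq (axpy (-1) (trunc D f) f i).
have hE i : h i = nsq (f i) - nsq (trunc D f i).
  rewrite /h /axpy /trunc; case: ifP => _; first by rewrite mulN1r addNr nsq0 subrr.
  by rewrite mulr0 add0r nsq0 subr0.
have st : rsummable (fun i => nsq (trunc D f i)).
  by apply: (rsummable_finite finD) => i Di; rewrite trunc_off// nsq0.
rewrite -(@eq_esum _ _ D (fun i => (nsq (trunc D f i))%:E)); last first.
  by move=> i Di; rewrite /trunc mem_set.
rewrite -(@esum_eq0_off _ _ D (fun i => (nsq (trunc D f i))%:E)); last first.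
  by move=> i Di; rewrite trunc_off// nsq0.
rewrite (rsummable_esum (fun=> nsq_ge0 _) st) lte_fin => lt_e; exists D => //.
rewrite -(@ltr_pXn2r _ 2)// ?nnegrE ?norm2_ge0 ?ltW// norm2_sqr.
rewrite [ltLHS](_ : _ = rsum (fun i => nsq (f i) - nsq (trunc D f i))); last first.
  by congr rsum; apply/funext => i; exact: hE.
rewrite rsumB_ge0//; last by move=> i; exact: nsq_ge0.
by move: lt_e; rewrite ltrBlDr addrC -ltrBlDr.
Qed.

End hilbert.

(** * Integrals against combinations of restricted measures *)

Section measures.
Context {R : realType}.
Local Notation mR := (measurableTypeR R).
Implicit Types m : {measure set mR -> \bar R}.

Lemma integral_gt0_eq0 m (S : set mR) (f : mR -> R) : measurable S ->
  measurable_fun S f -> (forall t, S t -> 0 < f t) ->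
  (\int[m]_(t in S) (f t)%:E = 0)%E -> m S = 0%E.
Proof.
move=> mS mf f0 If.
have : (\int[m]_(t in S) `|(f t)%:E| = 0)%E.
  rewrite -[RHS]If; apply: eq_integral => t; rewrite inE => /f0 ft.
  by rewrite /= gtr0_norm.
move=> /ae_eq_integral_abs; case=> //; first exact/measurable_EFinP.
move=> N [mN N0 SN]; apply: (subset_measure0 mS mN _ N0) => t St; apply: SN => /=.
by move=> /(_ St) [] /eqP; rewrite gt_eqF// f0.
Qed.

Lemma Rintegral_mscale (k : {nonneg R}) m (D : set mR) (f : mR -> R) :
  measurable D -> m.-integrable D (EFin \o f) ->
  Rintegral (mscale k m) D f = k%:num * Rintegral m D f.
Proof.
move=> mD intf; have mf := measurable_int _ intf.
rewrite /Rintegral integralE [in RHS]integralE.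
rewrite !ge0_integral_mscale//; last 2 first.
- exact: measurable_funeneg.
- exact: measurable_funepos.
move: (integrable_pos_fin_num mD intf) (integrable_neg_fin_num mD intf).
move: (\int[m]_(t in D) _)%E (\int[m]_(t in D) _)%E => A B finA finB.
by rewrite !fineB ?fin_numM// !fineM// mulrBr.
Qed.

(** The measure of a vector f + c E(S) f is the one of f off S, and a multiple
    of it on S.  The integral with respect to it splits accordingly. *)
Lemma Rintegral_split (k : {nonneg R}) m m' (S : set mR) (f : mR -> R) :
  measurable S ->
  (forall T, measurable T -> m' T = m (T `&` ~` S) + k%:num%:E * m (T `&` S))%E ->
  m.-integrable setT (EFin \o f) ->
  Rintegral m' setT f = k%:num * Rintegral m S f + Rintegral m (~` S) f.
Proof.
move=> mS m'E intf; have mCS := measurableC mS.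
have intf' : m'.-integrable setT (EFin \o f).
  apply/integrableP; have /integrableP[mf If] := intf; split=> //.
  have k0 : 0 <= 1 + k%:num :> R by rewrite addr_ge0.
  apply: (@le_lt_trans _ _ (\int[mscale (NngNum k0) m]_t `|(EFin \o f) t|)%E).
    apply: ge0_le_measure_integral => //; last exact: measurableT_comp.
    move=> T mT; rewrite m'E//.
    rewrite [leRHS](_ : _ = (m T + k%:num%:E * m T)%E); last first.
      transitivity ((1 + k%:num)%:E * m T)%E; first by [].
      by rewrite EFinD ge0_muleDl ?mul1e.
    apply: leeD; last by apply: lee_wpmul2l => //; apply: le_measure;
      rewrite ?inE//; exact: measurableI.
    by apply: le_measure; rewrite ?inE//; exact: measurableI.
  rewrite ge0_integral_mscale//; last exact: measurableT_comp.
  by rewrite lte_mul_pinfty.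
rewrite -(setUv S) Rintegral_setU//; last 2 first.
- by rewrite setUv.
- by apply/disj_setPS => x [].
congr (_ + _).
  rewrite -Rintegral_mscale//; last exact: integrableS intf.
  rewrite /Rintegral; congr fine; apply: eq_measure_integral => T mT TS.
  rewrite m'E// (setIidl TS) (_ : T `&` ~` S = set0) ?measure0 ?add0e//.
  by apply/seteqP; split => // x [/TS].
rewrite /Rintegral; congr fine; apply: eq_measure_integral => T mT TS.
rewrite m'E// (setIidl TS) (_ : T `&` S = set0) ?measure0 ?mule0 ?adde0//.
by apply/seteqP; split => // x [/TS].
Qed.

End measures.

(** * Diagonal operators and their spectral measures *)

Section diagonal.
Context {R : realType} {I : countType}.
Local Notation C := R[i].
Local Notation mR := (measurableTypeR R).
Implicit Types (d : I -> R) (f g : I -> C).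

Definition diag d : operator R I I :=
  [set fg | [/\ l2 fg.1, l2 fg.2 & fg.2 = fun i => ((d i)%:C)%C * fg.1 i]].

(** Indices are enumerated by [pickle_inv], so that the measure
    \sum_i |f_i|^2 \delta_(d_i) is a series of measures indexed by [nat]. *)
Definition diag_atom d f n : {measure set mR -> \bar R} :=
  if pickle_inv n is Some i then mscale (NngNum (nsq_ge0 (f i))) (dirac (d i : mR))
  else mzero.

Definition diag_measure d f : {measure set mR -> \bar R} :=
  mseries (diag_atom d f) 0.

Lemma integral_diag_measure d f (g : mR -> \bar R) :
  measurable_fun setT g -> (forall t, 0 <= g t)%E ->
  (\int[diag_measure d f]_t g t =
   \esum_(i in [set: I]) ((nsq (f i))%:E * g (d i)))%E.
Proof.
move=> mg g0; rewrite ge0_integral_measure_series//.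
have atom_ge0 n : (0 <= \int[diag_atom d f n]_t g t)%E by exact: integral_ge0.
rewrite nneseries_esumT// (@esum_inj _ _ _ (@pickle I)).
- apply: eq_esum => i _; rewrite /diag_atom pickleK_inv.
  by rewrite ge0_integral_mscale// integral_dirac// diracT mul1e.
- exact: pcan_inj pickleK_inv.
- move=> n; rewrite /diag_atom; have := @pickle_invK I n.
  case: pickle_inv => [i /= <- []|_ _]; first by exists i.
  by rewrite integral_measure_zero.
Qed.

Lemma diag_measureE d f (S : set mR) : measurable S ->
  diag_measure d f S =
  (\esum_(i in [set: I]) (nsq (trunc (d @^-1` S) f i))%:E)%E.
Proof.
move=> mS; rewrite -[S in LHS]setIT -integral_indic// integral_diag_measure//.
- apply: eq_esum => i _; rewrite /trunc indicE.
  rewrite (_ : (i \in d @^-1` S) = (d i \in S)) ?inE//.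
  by case: (d i \in S); rewrite ?mule1 ?mule0 ?nsq0.
- exact/measurable_EFinP/measurable_indic.
Qed.

End diagonal.

Section spectral.
Context {R : realType} {I : countType}.
Local Notation C := R[i].
Local Notation mR := (measurableTypeR R).
Implicit Types (d : I -> R) (f g : I -> C).

(** The projection of a Borel set S cuts a vector down to the coordinates i
    with d_i in S. *)
Lemma spectral_measure_diag d :
  spectral_measure (fun S : set mR => trunc (d @^-1` S)) (diag_measure d).
Proof.
split.
- move=> S mS; split=> [f|f _|f g _ _].
  + exact: l2_trunc.
  + by rewrite -truncI setIid.
  + exact: inner_trunc.
- by move=> f _; rewrite preimage_setT truncT.
- by move=> S T _ _ f _; rewrite preimage_setI truncI.
- move=> f S lf mS; rewrite diag_measureE// inner_trunc_self /=.
  rewrite norm2_sqr rsummable_esum//; first by move=> i; exact: nsq_ge0.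
  exact: (l2P _).1 (l2_trunc _ lf).
Qed.

(** The polarization identity for a single coordinate, with weight t. *)
Lemma polarization (z w : C) (t : R) :
  4^-1 * (\sum_(k < 4) ('i%C ^+ k * ((nsq ('i%C ^+ k * w + z) * t)%:C)%C)) =
  (t%:C)%C * z * conjc w.
Proof.
apply: (@mulfI _ 4); first by rewrite pnatr_eq0.
rewrite mulVKf ?pnatr_eq0//.
rewrite !big_ord_recl big_ord0 /= /bump /= !addn0 !addn1 ?add1n.
rewrite expr0 expr1 (_ : 'i%C ^+ 2 = -1); last exact: sqr_i.
rewrite (_ : 'i%C ^+ 3 = - 'i%C); last by rewrite exprS sqr_i mulrN1.
rewrite -(rmorph_nat (real_complex R)).
case: z w => a b [c d']; rewrite /nsq; simpc => /=.
by congr Complex; ring.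
Qed.

Section with_diag_measure.
Variables (d : I -> R) (mu : (I -> C) -> {measure set mR -> \bar R}).
Hypothesis muE : forall f, l2 f -> forall S, measurable S ->
  mu f S = diag_measure d f S.
Variables (phi : R -> R).
Hypothesis mphi : measurable_fun [set: mR] (phi : mR -> R).
Hypothesis phi_ge0 : forall i, 0 <= phi (d i).

Lemma integral_spectral f (h : mR -> R) : l2 f -> measurable_fun setT h ->
  (forall t, 0 <= h t) ->
  (\int[mu f]_t (h t)%:E =
   \esum_(i in [set: I]) (nsq (f i) * h (d i))%:E)%E.
Proof.
move=> lf mh h0; rewrite (eq_measure_integral (diag_measure d f)); last first.
  by move=> S mS _; exact: muE.
rewrite integral_diag_measure//; first exact/measurable_EFinP.
Qed.

Lemma spectral_domainP f :
  spectral_domain mu phi f <-> l2 f /\ l2 (fun i => ((phi (d i))%:C)%C * f i).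
Proof.
rewrite /spectral_domain /=.
suff E : l2 f -> (\int[mu f]_t ((phi t) ^+ 2)%:E)%E =
    sqnorm (fun i => ((phi (d i))%:C)%C * f i).
  by split=> -[lf h]; split=> //; move: h; rewrite /l2 E.
move=> lf; rewrite integral_spectral//; last 2 first.
- exact: measurable_funX.
- by move=> t; exact: sqr_ge0.
by rewrite sqnormE; apply: eq_esum => i _; rewrite nsqM nsqr mulrC.
Qed.

Lemma Rintegral_spectral f : l2 f ->
  Rintegral (mu f) setT phi = rsum (fun i => nsq (f i) * phi (d i)).
Proof.
move=> lf; rewrite rsum_ge0E => [|i]; last by rewrite mulr_ge0// nsq_ge0.
rewrite /Rintegral; congr fine; rewrite integralE.
have -> : (\int[mu f]_t ((fun x => (phi x)%:E)^\- t) = 0)%E.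
  transitivity (\int[mu f]_t (Num.max (- phi t) 0)%:E)%E.
    by apply: eq_integral => t _; rewrite funenegE EFin_max.
  rewrite integral_spectral//; last 2 first.
  - by apply: measurable_maxr => //; exact: measurableT_comp.
  - by move=> t; rewrite le_max lexx orbT.
  apply: esum1 => i _; rewrite max_r ?mulr0//.
  by rewrite oppr_le0.
rewrite sube0; transitivity (\int[mu f]_t (Num.max (phi t) 0)%:E)%E.
  by apply: eq_integral => t _; rewrite funeposE EFin_max.
rewrite integral_spectral//; last 2 first.
- exact: measurable_maxr.
- by move=> t; rewrite le_max lexx orbT.
by apply: eq_esum => i _; rewrite max_l.
Qed.

(** Polarization in each coordinate identifies the form of \int phi dE with
    that of the diagonal operator, and vectors of the domain suffice to test
    because they include the e_i.  Nonnegativity of phi on the entries means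
    that the negative part of phi does not contribute to any integral. *)
Lemma spectral_integral_diag :
  spectral_integral mu phi = diag (fun i => phi (d i)).
Proof.
have pol f h : spectral_domain mu phi f -> spectral_domain mu phi h ->
    4^-1 * \sum_(k < 4) ('i%C ^+ k *
      (\int[mu (axpy ('i%C ^+ k) h f)]_t phi t)%:C%C) =
    inner (fun i => ((phi (d i))%:C)%C * f i) h.
  move=> /spectral_domainP[lf lpf] /spectral_domainP[lh lph].
  pose u k := axpy ('i%C ^+ k) h f.
  have lu k : l2 (u k) by exact: l2_axpy.
  have lpu k : l2 (fun i => ((phi (d i))%:C)%C * u k i).
    have -> : (fun i => ((phi (d i))%:C)%C * u k i) =
        axpy ('i%C ^+ k) (fun i => ((phi (d i))%:C)%C * h i)
          (fun i => ((phi (d i))%:C)%C * f i).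
      by apply/funext => i; rewrite /u /axpy; ring.
    exact: l2_axpy.
  have su k : csummable (fun i => ((nsq (u k i) * phi (d i))%:C)%C).
    split; last by apply: (@rsummable_finite _ _ set0).
    apply: (rsummable_le _ (rsummableD ((l2P _).1 (lu k)) ((l2P _).1 (lpu k)))).
    move=> i /=; rewrite ger0_norm ?mulr_ge0 ?nsq_ge0//.
    rewrite nsqM nsqr -[X in X + _]mul1r -mulrDl [leLHS]mulrC.
    by rewrite ler_wpM2r ?nsq_ge0//; have := sqr_ge0 (1 - phi (d i));
      have := sqr_ge0 (phi (d i)); nra.
  have zu k := csummableZ ('i%C ^+ k) (su k).
  rewrite [X in 4^-1 * X](_ : _ = csum (fun i => \sum_(k < 4) ('i%C ^+ k *
      ((nsq ('i%C ^+ k * h i + f i) * phi (d i))%:C)%C))); last first.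
    transitivity (\sum_(k < 4) csum (fun i => 'i%C ^+ k *
        ((nsq (u k i) * phi (d i))%:C)%C)).
      apply: eq_bigr => k _; rewrite (Rintegral_spectral (lu k)) -csum_real.
      by rewrite -(csumZ _ (su k)).
    by rewrite -(@csum_sum _ _ 4 (fun k i => 'i%C ^+ k * ((nsq (u k i) * phi (d i))%:C)%C)).
  rewrite -csumZ; last first.
    exact: (@csummable_sum _ _ 4 (fun k i => 'i%C ^+ k * ((nsq (u k i) * phi (d i))%:C)%C)).
  by rewrite /inner; congr csum; apply/funext => i; exact: polarization.
apply/seteqP; split=> -[f g] /=.
  move=> [] /= df lg H; have [lf lpf] := (spectral_domainP f).1 df.
  split=> //=; apply/funext => i.
  have dom_i : spectral_domain mu phi (basis i).
    apply/spectral_domainP; split; first exact: l2_basis.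
    apply: (l2_finite (finite_set1 i)) => j /eqP/negPf.
    by rewrite /basis => ->; rewrite mulr0.
  by have := H _ dom_i; rewrite pol// !inner_basisr.
move=> [] /= lf lg gE.
have df : spectral_domain mu phi f by apply/spectral_domainP; rewrite -gE.
by split=> //= h dh; rewrite pol// -gE.
Qed.

End with_diag_measure.

End spectral.

(** * Uniqueness of the spectral measure of a diagonal operator *)

Section spectral_uniqueness.
Context {R : realType} {I : countType}.
Local Notation C := R[i].
Local Notation mR := (measurableTypeR R).
Implicit Types (f g : I -> C).

(** The axioms state the symmetry of the projections and not their linearity,
    so a projection of a combination is moved to the other side of an inner
    product before the combination is expanded. *)
Section fixed_measure.
Variables (E : set mR -> (I -> C) -> (I -> C))
  (mu : (I -> C) -> {measure set mR -> \bar R}).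
Hypothesis specE : spectral_measure E mu.

Lemma spectral_l2 S f : measurable S -> l2 f -> l2 (E S f).
Proof. by case: specE => + _ _ _ => /[apply] -[H _ _]; exact: H. Qed.

Lemma spectral_sym S f g : measurable S -> l2 f -> l2 g ->
  inner (E S f) g = inner f (E S g).
Proof. by case: specE => + _ _ _ => /[apply] -[_ _ H]; exact: H. Qed.

Lemma spectral_idem S f : measurable S -> l2 f -> E S (E S f) = E S f.
Proof. by case: specE => + _ _ _ => /[apply] -[_ H _]; exact: H. Qed.

Lemma spectral_setI S T f : measurable S -> measurable T -> l2 f ->
  E (S `&` T) f = E S (E T f).
Proof. by case: specE => _ _ + _ => H mS mT; exact: H. Qed.

Lemma spectral_setT f : l2 f -> E setT f = f.
Proof. by case: specE => _ H _ _; exact: H. Qed.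

Lemma spectral_mu S f : measurable S -> l2 f -> mu f S = (complex.Re (inner (E S f) f))%:E.
Proof. by case: specE => _ _ _ H mS lf; exact: H. Qed.

Lemma spectral_inner_self S f : measurable S -> l2 f ->
  inner (E S f) f = ((norm2 (E S f) ^+ 2)%:C)%C.
Proof.
by move=> mS lf; rewrite -inner_self -spectral_sym ?spectral_idem//; exact: spectral_l2.
Qed.

Lemma spectral_mu_norm S f : measurable S -> l2 f -> mu f S = (norm2 (E S f) ^+ 2)%:E.
Proof. by move=> mS lf; rewrite spectral_mu// spectral_inner_self. Qed.

Lemma spectral_inner S f : measurable S -> l2 f ->
  inner f (E S f) = ((fine (mu f S))%:C)%C.
Proof. by move=> mS lf; rewrite -spectral_sym// spectral_inner_self// spectral_mu_norm. Qed.

Lemma spectral_inner2 S T f : measurable S -> measurable T -> l2 f ->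
  inner (E S f) (E T f) = ((fine (mu f (T `&` S)))%:C)%C.
Proof.
move=> mS mT lf; rewrite spectral_sym//; last exact: spectral_l2.
by rewrite -spectral_setI// spectral_inner// 1?setIC//; exact: measurableI.
Qed.

(** E(S) f and f - E(S) f have orthogonal projections, and the vector
    c E(S) f + f is (1 + c) E(S) f plus f - E(S) f. *)
Lemma spectral_mu_axpy (c : C) S f : measurable S -> l2 f ->
  forall T, measurable T ->
  (mu (axpy c (E S f) f) T = mu f (T `&` ~` S) + (nsq (1 + c))%:E * mu f (T `&` S))%E.
Proof.
move=> mS lf T mT; have lEf := spectral_l2 mS lf.
have lu : l2 (axpy c (E S f) f) by exact: l2_axpy.
have lET : l2 (E T f) by exact: spectral_l2.
have mTS : measurable (T `&` S) by exact: measurableI.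
have mTCS : measurable (T `&` ~` S) by exact/measurableI/measurableC.
have lETS : l2 (E T (E S f)) by exact: spectral_l2.
have finmu A : measurable A -> exists a, mu f A = a%:E.
  by move=> mA; rewrite spectral_mu_norm//; eexists.
rewrite spectral_mu// spectral_sym//.
have -> : inner (axpy c (E S f) f) (E T (axpy c (E S f) f)) =
    conjc c * inner (axpy c (E S f) f) (E T (E S f)) +
    inner (axpy c (E S f) f) (E T f).
  rewrite -spectral_sym// inner_axpyr//; last exact: spectral_l2.
  by rewrite !spectral_sym.
rewrite !inner_axpyl// -spectral_setI//.
rewrite spectral_inner2// spectral_inner2// spectral_inner// spectral_inner//.
rewrite -setIA setIid.
have muT : (mu f T = mu f (T `&` ~` S) + mu f (T `&` S))%E.
  rewrite -measureU//; last by apply/seteqP; split => // x [[_ ?] [_ ?]].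
  by rewrite -setIUr setvU setIT.
have [[a aE] [b bE]] := (finmu _ mTS, finmu _ mTCS).
rewrite muT aE bE -EFinD -EFinM -EFinD; congr EFin => /=; rewrite /nsq.
by case: c {lu} => x y; simpc => /=; ring.
Qed.

End fixed_measure.
End spectral_uniqueness.

Section eigenvectors.
Context {R : realType} {I : countType}.
Local Notation C := R[i].
Local Notation mR := (measurableTypeR R).
Variables (d : I -> R) (E : set mR -> (I -> C) -> (I -> C))
  (mu : (I -> C) -> {measure set mR -> \bar R}).
Hypotheses (specE : spectral_measure E mu)
  (AE : diag d = spectral_integral mu id).

Lemma measurable_idR : measurable_fun [set: mR] (id : mR -> R).
Proof. exact: measurable_id. Qed.

Lemma diag_basis (i : I) : diag d (basis i, fun j => ((d i)%:C)%C * basis i j).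
Proof.
split=> /=; first exact: l2_basis.
  apply: (l2_finite (finite_set1 i)) => j /eqP/negPf.
  by rewrite /basis => ->; rewrite mulr0.
apply/funext => j; rewrite /basis; case: eqVneq => [-> //|_].
by rewrite !mulr0.
Qed.

Lemma spectral_basis_sqr i : (\int[mu (basis i)]_t (t ^+ 2)%:E < +oo)%E.
Proof. by have := diag_basis i; rewrite AE => -[/= [_]]. Qed.

(** The vector e_i lies in the domain of A, so its measure has a finite second
    moment; it is finite, hence has a finite first moment as well. *)
Lemma integrable_basis i : (mu (basis i)).-integrable setT (EFin \o (id : mR -> R)).
Proof.
apply/integrableP; split; first by apply/measurable_EFinP; exact: measurable_idR.
apply: (@le_lt_trans _ _ (\int[mu (basis i)]_t (1 + (t ^+ 2)%:E))%E).
  (* |t| <= 1 + t^2 *)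
  apply: ge0_le_integral => //=.
  - by apply/measurable_EFinP; exact: normr_measurable.
  - apply: emeasurable_funD => //; apply/measurable_EFinP.
    by apply: measurable_funX; exact: measurable_idR.
  - move=> t _; rewrite -EFinD lee_fin ler_norml; have := sqr_ge0 (1 - t).
    have := sqr_ge0 (1 + t); have := sqr_ge0 t => *.
    by apply/andP; split; nra.
rewrite ge0_integralD//; last 2 first.
- by move=> t _; rewrite lee_fin sqr_ge0.
- by apply/measurable_EFinP; apply: measurable_funX; exact: measurable_idR.
rewrite integral_cst// mul1e; apply: lte_add_pinfty; last exact: spectral_basis_sqr.
by rewrite (spectral_mu_norm specE)// ?ltry//; exact: l2_basis.
Qed.

Lemma spectral_domain_restr i (S : set mR) : measurable S ->
  spectral_domain mu id (E S (basis i)).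
Proof.
move=> mS; have le := @l2_basis R I i; have lEe := spectral_l2 specE mS le.
split=> //; apply: le_lt_trans (spectral_basis_sqr i).
apply: ge0_le_measure_integral => //; last 2 first.
- by move=> t; rewrite lee_fin sqr_ge0.
- by apply/measurable_EFinP; apply: measurable_funX; exact: measurable_idR.
move=> T mT; have mTS : measurable (T `&` S) by exact: measurableI.
rewrite (spectral_mu specE)// -(spectral_setI specE)// (spectral_inner2 specE)//=.
rewrite setIA setIAC setIid setIC fineK; last by rewrite (spectral_mu_norm specE).
by apply: le_measure; rewrite ?inE//; exact: subIsetl.
Qed.

(** The four squared norms |1 + i^k|^2 are 4, 2, 0, 2: the polarization sum
    keeps the contribution K of the set S and cancels the contribution J of its
    complement. *)
Lemma polarization_moment (K J : R) :
  4^-1 * (\sum_(k < 4) ('i%C ^+ k *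
    ((nsq (1 + 'i%C ^+ k) * K + J)%:C)%C)) = (K%:C)%C :> C.
Proof.
apply: (@mulfI _ 4); first by rewrite pnatr_eq0.
rewrite mulVKf ?pnatr_eq0//.
rewrite !big_ord_recl big_ord0 /= /bump /= !addn0 !addn1 ?add1n.
rewrite expr0 expr1 (_ : 'i%C ^+ 2 = -1); last exact: sqr_i.
rewrite (_ : 'i%C ^+ 3 = - 'i%C); last by rewrite exprS sqr_i mulrN1.
rewrite -(rmorph_nat (real_complex R)) -(rmorph1 (real_complex R)).
by rewrite /nsq; simpc => /=; congr Complex; ring.
Qed.

(** This is A e_i = d_i e_i tested against E(S) e_i: the left-hand side arises
    from the definition of \int t dE, the right-hand side from the eigenvalue. *)
Lemma Rintegral_basis i (S : set mR) : measurable S ->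
  Rintegral (mu (basis i)) S id = d i * fine (mu (basis i) S).
Proof.
move=> mS; have le := @l2_basis R I i; have lEe := spectral_l2 specE mS le.
have := diag_basis i; rewrite AE => -[/= _ _ /(_ _ (spectral_domain_restr i mS))].
rewrite inner_scalel// (spectral_inner specE)// [X in _ = 4^-1 * X](_ : _ =
  \sum_(k < 4) ('i%C ^+ k * ((nsq (1 + 'i%C ^+ k) *
    Rintegral (mu (basis i)) S id + Rintegral (mu (basis i)) (~` S) id)%:C)%C)); last first.
  apply: eq_bigr => k _; congr (_ * (_%:C)%C).
  apply: (@Rintegral_split _ (NngNum (nsq_ge0 (1 + 'i%C ^+ k)))) => //.
    exact: (spectral_mu_axpy specE _ mS le).
  exact: integrable_basis.
by rewrite polarization_moment -rmorphM => /complexI.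
Qed.

Lemma Rintegral_basis_shift i (c : R) (S : set mR) : measurable S ->
  Rintegral (mu (basis i)) S (fun t => c * (t - d i)) = 0 /\
  (mu (basis i)).-integrable S (EFin \o (fun t : mR => c * (t - d i))).
Proof.
move=> mS; have intS := integrableS measurableT mS (@subsetT _ _) (integrable_basis i).
have intc : (mu (basis i)).-integrable S (EFin \o cst (d i)).
  apply/integrableP; split; first by apply/measurable_EFinP; exact: measurable_cst.
  rewrite [X in (X < _)%E](_ : _ = \int[mu (basis i)]_(x in S) (cst `|(d i)%:E|%E) x)%E//.
  rewrite integral_cst// (spectral_mu_norm specE)//; last exact: l2_basis.
  by rewrite -EFinM ltry.
have intB : (mu (basis i)).-integrable S (EFin \o (fun t : mR => t - d i)).
  exact: (integrableB mS intS intc).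
split; last exact: (integrableZl mS c intB).
rewrite (RintegralZl c mS intB) (RintegralB mS intS intc) Rintegral_basis//.
by rewrite Rintegral_cst// subrr mulr0.
Qed.

(** Used with c = 1 to the right of d_i and c = -1 to the left of it. *)
Lemma mu_basis_sgn i (c : R) (S : set mR) : measurable S ->
  (forall t, S t -> 0 < c * (t - d i)) -> mu (basis i) S = 0%E.
Proof.
move=> mS S0; have [I0 intS] := Rintegral_basis_shift i c mS.
apply: (integral_gt0_eq0 mS _ S0).
  by apply/measurable_EFinP; exact: measurable_int intS.
by rewrite -[LHS]fineK ?(integrable_fin_num mS intS)// -/(Rintegral _ _ _) I0.
Qed.

(** As the measure of e_i is carried by d_i, the projection of the singleton
    d_i fixes e_i, and E(S) e_i is e_i or 0 according to whether d_i is in S. *)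
Lemma spectral_basis i (S : set mR) : measurable S ->
  E S (basis i) = trunc (d @^-1` S) (basis i).
Proof.
move=> mS; have le := @l2_basis R I i.
have m1 : measurable ([set d i] : set mR) by exact: measurable_set1.
have mC : measurable (~` [set d i] : set mR) by exact: measurableC.
have E_null T : measurable T -> mu (basis i) T = 0%E -> E T (basis i) = fun=> 0.
  move=> mT; rewrite (spectral_mu_norm specE)// => -[]; apply: norm2_eq0.
  exact: (spectral_l2 specE).
have muC : mu (basis i) (~` [set d i]) = 0%E.
  rewrite (_ : ~` [set d i] = [set t | t < d i] `|` [set t | d i < t]).
    have mlt : measurable ([set t | t < d i] : set mR).
      by rewrite -set_itvNyo; exact: measurable_itv.
    have mgt : measurable ([set t | d i < t] : set mR).
      by rewrite -set_itvoy; exact: measurable_itv.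
    apply: (null_set_setU mlt mgt).
      by apply: (@mu_basis_sgn _ (-1)) => // t /=; rewrite mulN1r oppr_gt0 subr_lt0.
    by apply: (@mu_basis_sgn _ 1) => // t /=; rewrite mul1r subr_gt0.
  apply/seteqP; split=> t /=; first by move/eqP; rewrite neq_lt => /orP.
  by move=> /orP; rewrite -neq_lt => /eqP.
(* The squared norm of e_i - E({d_i}) e_i is 1 - m({d_i}) = 0. *)
have E1 : E [set d i] (basis i) = basis i.
  have ECl2 := spectral_l2 specE mC le; have E1l2 := spectral_l2 specE m1 le.
  have mu1 : mu (basis i) [set d i] = 1%E.
    have muT : mu (basis i) setT = 1%E.
      rewrite (spectral_mu_norm specE)// (spectral_setT specE)//; congr EFin; apply: complexI.
      by rewrite -inner_self inner_basisr /basis eqxx.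
    rewrite -muT -(setUv [set d i]) measureU ?setICr//.
    by rewrite -[LHS]adde0; congr (_ + _)%E; rewrite -muC.
  have : axpy (-1) (E [set d i] (basis i)) (basis i) = fun=> 0.
    apply: norm2_eq0; first exact: l2_axpy.
    apply: complexI; rewrite -inner_self inner_axpyl//; last exact: l2_axpy.
    rewrite !inner_axpyr// (spectral_inner2 specE)// setIid (spectral_inner specE)//.
    rewrite (spectral_inner_self specE)// -[norm2 _ ^+ 2]/(fine (_ ^+ 2)%:E).
    rewrite -(spectral_mu_norm specE)// mu1.
    by rewrite inner_basisr /basis eqxx /=; simpc; rewrite ?subrr ?addNr.
  move=> H; apply/funext => j; have := congr1 (@^~ j) H; rewrite /axpy.
  by move/eqP; rewrite mulN1r addrC subr_eq0 => /eqP.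
rewrite -[in LHS]E1 -(spectral_setI specE)//; apply/funext => j.
have [Sdi|nSdi] := pselect (S (d i)).
  rewrite (_ : S `&` _ = [set d i]) ?E1; last first.
    by apply/seteqP; split => t /=; [case|move=> ->].
  rewrite /trunc /basis; case: eqVneq => [->|]; last by case: ifP.
  by rewrite mem_set.
rewrite (_ : S `&` _ = set0); last first.
  by apply/seteqP; split => t //= -[St tE]; apply: nSdi; rewrite -tE.
rewrite E_null// /trunc /basis; case: eqVneq => [->|]; last by case: ifP.
by rewrite memNset.
Qed.

(** Coordinates are inner products with the e_i, and E(S) moves to the other
    side. *)
Lemma spectral_diag_projE f (S : set mR) : l2 f -> measurable S ->
  E S f = trunc (d @^-1` S) f.
Proof.
move=> lf mS; apply/funext => i; rewrite -[LHS]inner_basisr (spectral_sym specE)//.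
  by rewrite spectral_basis// -inner_trunc inner_basisr.
exact: l2_basis.
Qed.

Lemma spectral_diag_muE f : l2 f -> forall S : set mR, measurable S ->
  mu f S = diag_measure d f S.
Proof.
move=> lf S mS; have [_ _ _ H] := @spectral_measure_diag R I d.
by rewrite H// (spectral_mu specE)// spectral_diag_projE.
Qed.

End eigenvectors.

(** Existence of a spectral measure comes from [spectral_measure_diag]; any
    other one yields the same measures, hence the same power. *)
Lemma opow_diag (R : realType) (I : countType) (d : I -> R) (s : R) :
  (forall i, 0 <= d i) -> opow (diag d) s = diag (fun i => d i `^ s).
Proof.
move=> d0; have mpow := @measurable_powR R s.
have mid : measurable_fun [set: measurableTypeR R] (id : measurableTypeR R -> R).
  exact: measurable_id.
have canonE f : l2 f -> forall S : set (measurableTypeR R), measurable S ->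
  diag_measure d f S = diag_measure d f S by [].
apply: xget_unique.
  exists (fun S => trunc (d @^-1` S)), (diag_measure d); split.
  - exact: spectral_measure_diag.
  - by rewrite (spectral_integral_diag canonE mid).
  - by rewrite (spectral_integral_diag canonE mpow)// => i; exact: powR_ge0.
move=> T [E [mu [specE AE ->]]].
by rewrite (spectral_integral_diag (spectral_diag_muE specE AE) mpow)// => i; exact: powR_ge0.
Qed.

(** * Multiplication by real weights *)

Section weights.
Context {R : realType}.
Local Notation C := R[i].
Implicit Types I J : choiceType.

Definition wt I (d : I -> R) (f : I -> C) : I -> C := fun i => ((d i)%:C)%C * f i.

Lemma wt_wt I (u v : I -> R) f : wt u (wt v f) = wt (fun i => u i * v i) f.
Proof. by apply/funext => i; rewrite /wt rmorphM mulrA. Qed.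

Lemma wtD I (u v : I -> R) f :
  (fun i => wt u f i + wt v f i) = wt (fun i => u i + v i) f.
Proof. by apply/funext => i; rewrite /wt rmorphD mulrDl. Qed.

Lemma nsq_wt I (d : I -> R) f i : nsq (wt d f i) = d i ^+ 2 * nsq (f i).
Proof. by rewrite nsqM nsqr. Qed.

Lemma l2_wt_le I (d d' : I -> R) f : (forall i, d i ^+ 2 <= d' i ^+ 2) ->
  l2 (wt d' f) -> l2 (wt d f).
Proof.
move=> dd /l2P l; apply: l2_le l => i.
by rewrite !nsq_wt ler_wpM2r// nsq_ge0.
Qed.

Lemma norm2_wt_le I (d d' : I -> R) f : (forall i, d i ^+ 2 <= d' i ^+ 2) ->
  l2 (wt d' f) -> norm2 (wt d f) <= norm2 (wt d' f).
Proof.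
move=> dd l; apply: norm2_le; apply: rsum_le.
- by move=> i; rewrite !nsq_wt ler_wpM2r// nsq_ge0.
- exact: (l2P _).1 (l2_wt_le dd l).
- exact: (l2P _).1 l.
Qed.

Lemma l2_wt_interp I (d d' : I -> R) f :
  (forall i, d i ^+ 2 <= 1 + d' i ^+ 2) -> l2 f -> l2 (wt d' f) -> l2 (wt d f).
Proof.
move=> dd /l2P l /l2P l'; apply: l2_le (rsummableD l l') => i.
rewrite !nsq_wt -[X in X + _]mul1r -mulrDl.
by rewrite ler_wpM2r// nsq_ge0.
Qed.

Lemma l2_wt_comb I (u v d : I -> R) (K : R) f :
  (forall i, d i ^+ 2 <= K * (u i ^+ 2 + v i ^+ 2)) ->
  l2 (wt u f) -> l2 (wt v f) -> l2 (wt d f).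
Proof.
move=> dK /l2P lu /l2P lv; apply: l2_le (rsummableZ K (rsummableD lu lv)) => i.
by rewrite !nsq_wt -mulrDl mulrA ler_wpM2r// nsq_ge0.
Qed.

(** On the domain of a sum of squares, u f is controlled by f and
    (u^2 + v^2) f because u^2 <= 1 + u^4. *)
Lemma l2_wt_sqr I (u v : I -> R) f : l2 f ->
  l2 (wt (fun i => u i ^+ 2 + v i ^+ 2) f) ->
  [/\ l2 (wt u f), l2 (wt v f), l2 (wt (fun i => u i * u i) f) &
      l2 (wt (fun i => v i * v i) f)].
Proof.
move=> lf l; split.
- apply: (l2_wt_interp _ lf l) => i.
  have := sqr_ge0 (u i ^+ 2 - 1); have := sqr_ge0 (u i * v i);
  have := sqr_ge0 (v i ^+ 2); have := sqr_ge0 (u i ^+ 2); nra.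
- apply: (l2_wt_interp _ lf l) => i.
  have := sqr_ge0 (v i ^+ 2 - 1); have := sqr_ge0 (u i * v i);
  have := sqr_ge0 (v i ^+ 2); have := sqr_ge0 (u i ^+ 2); nra.
- apply: (l2_wt_le _ l) => i; have := sqr_ge0 (u i * v i);
  have := sqr_ge0 (v i ^+ 2); nra.
- apply: (l2_wt_le _ l) => i; have := sqr_ge0 (u i * v i);
  have := sqr_ge0 (u i ^+ 2); nra.
Qed.

Lemma l2_wt_basis I (d : I -> R) i : l2 (wt d (basis i)).
Proof.
apply: (l2_finite (finite_set1 i)) => j /eqP/negPf.
by rewrite /wt /basis => ->; rewrite mulr0.
Qed.

Lemma norm2_wt_basis I (d : I -> R) i : norm2 (wt d (basis i)) = `|d i|.
Proof.
rewrite norm2E (@rsum_single _ _ i).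
  by rewrite nsq_wt /basis eqxx /nsq /= expr0n addr0 expr1n mulr1 sqrtr_sqr.
by move=> j /negPf; rewrite nsq_wt /basis => ->; rewrite nsq0 mulr0.
Qed.

Lemma inner_wt I (d : I -> R) (f g : I -> C) : inner (wt d f) g = inner f (wt d g).
Proof.
congr csum; apply/funext => i; rewrite /wt conjcM conjc_real.
by rewrite mulrCA mulrA.
Qed.

Lemma inner_ext I (g h : I -> C) :
  (forall i, inner (basis i) g = inner (basis i) h) -> g = h.
Proof.
move=> gh; apply/funext => i; have := gh i; rewrite !inner_basisl => /(congr1 conjc).
by rewrite !conjcK.
Qed.

Lemma l2_wt_trunc I (D : set I) (d : I -> R) (f : I -> C) :
  finite_set D -> l2 (wt d (trunc D f)).
Proof.
move=> finD; apply: (l2_finite finD) => i Di.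
by rewrite /wt trunc_off// mulr0.
Qed.

Lemma l2_trunc_finite I (D : set I) (f : I -> C) : finite_set D -> l2 (trunc D f).
Proof. by move=> finD; apply: (l2_finite finD) => i; exact: trunc_off. Qed.

Lemma densely_defined_finite I J (T : operator R I J) :
  (forall D f, finite_set D -> dom T (trunc D f)) -> densely_defined T.
Proof.
move=> domT f lf e e0; have [D finD De] := trunc_dense lf e0.
exists (trunc D f); split=> //; first exact: domT.
exact: l2_trunc_finite.
Qed.

End weights.

Section diagonal_operators.
Context {R : realType} {I : countType}.
Implicit Types d : I -> R.

Lemma diagP d f g : diag d (f, g) <-> [/\ l2 f, l2 (wt d f) & g = wt d f].
Proof. by split=> -[/= lf lg gE]; split=> //=; move: lg; rewrite gE. Qed.

Lemma self_adjoint_diag d : self_adjoint (diag d).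
Proof.
split.
  apply: densely_defined_finite => D f finD; exists (wt d (trunc D f)).
  by apply/diagP; split=> //; [exact: l2_trunc_finite|exact: l2_wt_trunc].
apply/seteqP; split=> -[g h] /=.
  move=> /diagP[lg lh ->]; split=> //= f k /diagP[lf lk ->].
  exact: inner_wt.
move=> [/= lg lh H]; split=> //=; apply: inner_ext => i.
rewrite -(H _ (wt d (basis i))) ?inner_wt//.
by apply/diagP; split=> //; [exact: l2_basis|exact: l2_wt_basis].
Qed.

(** The vectors e_i detect the comparison of entries, since x |-> x^s is
    strictly increasing; the converse is monotonicity of sums. *)
Lemma diag_pow_le d d' (s : R) : 0 < s -> (forall i, 0 <= d i) -> (forall i, 0 <= d' i) ->
  (dom (opow (diag d) s) `<=` dom (opow (diag d') s) /\
   forall f g h, opow (diag d) s (f, g) -> opow (diag d') s (f, h) ->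
     norm2 h <= norm2 g) <->
  forall i, d' i <= d i.
Proof.
move=> s0 d0 d'0; rewrite !opow_diag//; split=> [[_ le_norm] i|le_d].
  rewrite leNgt; apply/negP => dd'.
  (* On e_i the two norms are the powers of the two entries. *)
  have := le_norm (basis i) (wt (fun j => d j `^ s) (basis i))
    (wt (fun j => d' j `^ s) (basis i)).
  rewrite !norm2_wt_basis !ger0_norm ?powR_ge0// leNgt gt0_ltr_powR ?nnegrE//.
  by move=> H; have : false by apply: H; apply/diagP; split=> //;
    [exact: l2_basis|exact: l2_wt_basis|exact: l2_basis|exact: l2_wt_basis].
have le_pow j : (d' j `^ s) ^+ 2 <= (d j `^ s) ^+ 2.
  rewrite lerXn2r ?nnegrE ?powR_ge0//.
  by apply: (ge0_ler_powR (ltW s0)); rewrite ?nnegrE.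
split=> [f [g /diagP[lf lg _]]|f g h /diagP[lf lg ->] /diagP[_ _ ->]].
  exists (wt (fun i => d' i `^ s) f).
  exact: (diagP _ _ _).2 (And3 lf (l2_wt_le le_pow lg) erefl).
exact: (norm2_wt_le le_pow lg).
Qed.

End diagonal_operators.

(** * Weighted injections *)

Section weighted_injections.
Context {R : realType}.
Local Notation C := R[i].

(** Transport along an injection s from I to J, given through its partial
    inverse r: the family is extended by 0 outside of the range of s. *)
Definition push (V : nmodType) (I J : choiceType) (r : J -> option I)
    (f : I -> V) : J -> V :=
  fun j => if r j is Some i then f i else 0.

Section one_injection.
Variables (I J : choiceType) (s : I -> J) (r : J -> option I).
Hypotheses (sK : pcancel s r) (rK : ocancel r s).

Lemma push_s (V : nmodType) (f : I -> V) i : push r f (s i) = f i.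
Proof. by rewrite /push sK. Qed.

(** Phrased on the match itself, so that it rewrites an unfolded [push]. *)
Lemma push_off (T : Type) (x : T) (F : I -> T) j : ~ range s j ->
  (if r j is Some i then F i else x) = x.
Proof. by case: (r j) (rK j) => //= i <- []; exists i. Qed.

Lemma sqnorm_push (f : I -> C) : sqnorm (push r f) = sqnorm f.
Proof.
rewrite !sqnormE (esum_inj (pcan_inj sK)).
  by apply: eq_esum => i _; rewrite push_s.
by move=> j /(push_off 0 f); rewrite /push => ->; rewrite nsq0.
Qed.

Lemma l2_push (f : I -> C) : l2 (push r f) <-> l2 f.
Proof. by rewrite /l2 sqnorm_push. Qed.

Lemma inner_push (f : I -> C) g : inner (push r f) g = inner f (g \o s).
Proof.
rewrite /inner (csum_inj (pcan_inj sK)).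
  by congr csum; apply/funext => i /=; rewrite push_s.
by move=> j /(push_off 0 f); rewrite /push => ->; rewrite mul0r.
Qed.

Lemma push_comp (f : I -> C) : push r f \o s = f.
Proof. by apply/funext => i; exact: push_s. Qed.

Lemma push_wt (a : I -> R) (g : J -> C) : push r (wt a (g \o s)) = wt (push r a) g.
Proof.
apply/funext => j; rewrite /push /wt.
by case: (r j) (rK j) => /= [i <-//|_]; rewrite mul0r.
Qed.

Lemma wt_push (d : J -> R) (f : I -> C) :
  wt d (push r f) = push r (wt (d \o s) f).
Proof.
apply/funext => j; rewrite /push /wt /=.
by case: (r j) (rK j) => /= [i ->//|_]; rewrite mulr0.
Qed.

End one_injection.

Definition wpush (I J : choiceType) (r : J -> option I) (a : I -> R) :
    operator R I J :=
  [set fg | [/\ l2 fg.1, l2 fg.2 & fg.2 = push r (wt a fg.1)]].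

Lemma wpushP (I J : choiceType) (s : I -> J) (r : J -> option I) (sK : pcancel s r)
    (rK : ocancel r s) (a : I -> R) f g :
  wpush r a (f, g) <-> [/\ l2 f, l2 (wt a f) & g = push r (wt a f)].
Proof.
split=> -[/= lf lg gE]; split=> //=.
  by apply/(l2_push sK rK); rewrite -gE.
by rewrite gE; apply/(l2_push sK rK).
Qed.

(** The formula for the adjoint is forced by the vectors e_i and conversely
    holds against every vector by reindexing along s. *)
Lemma adjoint_wpush (I J : choiceType) (s : I -> J) (r : J -> option I)
    (sK : pcancel s r) (rK : ocancel r s) (a : I -> R) g h :
  adjoint (wpush r a) (g, h) <-> [/\ l2 g, l2 h & h = wt a (g \o s)].
Proof.
split=> -[/= lg lh H]; split=> //=.
  apply: inner_ext => i; rewrite -(H _ (push r (wt a (basis i)))).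
    by rewrite (inner_push sK rK) inner_wt.
  by apply/(wpushP sK rK); split=> //; [exact: l2_basis|exact: l2_wt_basis].
move=> f k /(wpushP sK rK)[lf laf ->].
by rewrite (inner_push sK rK) inner_wt H.
Qed.

Section compositions.
Variable I : countType.

Lemma comp_adjoint_wpush (s : I -> I) (r : I -> option I) (sK : pcancel s r)
    (rK : ocancel r s) (u : I -> R) f h :
  ocomp (adjoint (wpush r u)) (wpush r u) (f, h) <->
  [/\ l2 f, l2 (wt u f), l2 h & h = wt (fun i => u i * u i) f].
Proof.
split=> [[k /(wpushP sK rK)[/= lf luf ->] /(adjoint_wpush sK rK)[/= _ lh hE]]|].
  by split=> //; rewrite hE (push_comp sK) wt_wt.
move=> [lf luf lh hE]; exists (push r (wt u f)).
  by apply/(wpushP sK rK); split.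
apply/(adjoint_wpush sK rK); split=> //; first exact: (l2_push sK rK _).2.
by rewrite (push_comp sK) wt_wt.
Qed.

Lemma comp_wpush_adjoint (s : I -> I) (r : I -> option I) (sK : pcancel s r)
    (rK : ocancel r s) (u : I -> R) f h :
  ocomp (wpush r u) (adjoint (wpush r u)) (f, h) <->
  [/\ l2 f, l2 (wt (push r u) f), l2 h &
      h = wt (fun i => push r u i * push r u i) f].
Proof.
have pushE g : push r (wt u (wt u (g \o s))) =
    wt (fun i => push r u i * push r u i) g.
  rewrite -wt_wt -[in RHS](push_wt rK) -(push_wt rK); congr (push r (wt u _)).
  by rewrite (push_comp sK).
split.
  move=> [k /(adjoint_wpush sK rK)[/= lf lk kE] [/= _ lh hE]].
  split=> //; last by rewrite hE kE pushE.
  by rewrite -(push_wt rK); apply: (l2_push sK rK _).2; rewrite -kE.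
move=> [lf luf lh hE].
have luf' : l2 (wt u (f \o s)).
  by apply: (l2_push sK rK _).1; rewrite (push_wt rK).
exists (wt u (f \o s)); first by apply/(adjoint_wpush sK rK); split.
by split=> //=; rewrite hE pushE.
Qed.

(** Both C^* C and C C^* are described by a real weight u in this way: the
    domain asks for u f and u^2 f.  In the sum of two such operators the four
    conditions amount to a single one. *)
Lemma oadd_sqr_diag (X Y : operator R I I) (u v : I -> R) :
  (forall f h, X (f, h) <->
    [/\ l2 f, l2 (wt u f), l2 h & h = wt (fun i => u i * u i) f]) ->
  (forall f h, Y (f, h) <->
    [/\ l2 f, l2 (wt v f), l2 h & h = wt (fun i => v i * v i) f]) ->
  oadd X Y = diag (fun i => u i ^+ 2 + v i ^+ 2).
Proof.
move=> XP YP; apply/seteqP; split=> -[f h].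
  move=> [g1 [g2 [/= /XP[lf luf l1 g1E] /YP[_ lvf lg2 g2E] ->]]].
  apply/diagP; rewrite g1E g2E wtD; split=> //.
  by have := l2D l1 lg2; rewrite g1E g2E wtD.
move=> /diagP[lf lsf ->]; have [luf lvf luuf lvvf] := l2_wt_sqr lf lsf.
exists (wt (fun i => u i * u i) f), (wt (fun i => v i * v i) f); split=> /=.
- by apply/XP; split.
- by apply/YP; split.
- by rewrite wtD.
Qed.

End compositions.
End weighted_injections.

(** * The column operator, its polar decomposition and its mean transform *)

Section pair.
Context {R : realType}.
Local Notation C := R[i].
Variables (I : countType) (s1 s2 : I -> I) (r1 r2 : I -> option I).
Hypotheses (s1K : pcancel s1 r1) (r1K : ocancel r1 s1).
Hypotheses (s2K : pcancel s2 r2) (r2K : ocancel r2 s2).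
Variables (a b : I -> R).

Local Notation C1 := (wpush r1 a).
Local Notation C2 := (wpush r2 b).
Local Notation T := (pcolumn (C1, C2)).
Let sq i : R := a i ^+ 2 + b i ^+ 2.

(** B is diagonal with real entries, hence self-adjoint, so that only the
    comparison of the powers of two diagonals is left. *)
Lemma sph_components_wpush p : 0 < p ->
  sph_hyponormal_components p C1 C2 <->
  forall i, push r1 a i ^+ 2 + push r2 b i ^+ 2 <= a i ^+ 2 + b i ^+ 2.
Proof.
move=> p0; rewrite /sph_hyponormal_components.
rewrite (oadd_sqr_diag (comp_adjoint_wpush s1K r1K a) (comp_adjoint_wpush s2K r2K b)).
rewrite (oadd_sqr_diag (comp_wpush_adjoint s1K r1K a) (comp_wpush_adjoint s2K r2K b)).
have p20 : 0 < p / 2 by rewrite divr_gt0.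
rewrite -(diag_pow_le p20); last 2 first.
- by move=> i; rewrite addr_ge0 ?sqr_ge0.
- by move=> i; rewrite addr_ge0 ?sqr_ge0.
by split=> [[_ ? ?]|[? ?]]; split=> //; exact: self_adjoint_diag.
Qed.

Definition stack (u v : I -> C) : I + I -> C :=
  fun k => match k with inl j => push r1 u j | inr j => push r2 v j end.

Lemma sqnorm_stack u v : sqnorm (stack u v) = (sqnorm u + sqnorm v)%E.
Proof.
rewrite -(sqnorm_push s1K r1K u) -(sqnorm_push s2K r2K v) !sqnormE esum_sumtype//.
by move=> k; rewrite lee_fin nsq_ge0.
Qed.

Lemma l2_stack u v : l2 (stack u v) <-> l2 u /\ l2 v.
Proof.
rewrite l2_sumtype -[stack u v \o inl]/(push r1 u) -[stack u v \o inr]/(push r2 v).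
by rewrite (l2_push s1K r1K) (l2_push s2K r2K).
Qed.

Lemma inner_stack u v g : l2 u -> l2 v -> l2 g ->
  inner (stack u v) g = inner u (g \o inl \o s1) + inner v (g \o inr \o s2).
Proof.
move=> lu lv lg; have lc : l2 (stack u v) by apply/l2_stack.
rewrite -(inner_push s1K r1K) -(inner_push s2K r2K).
exact: csum_sumtype (l2_inner lc lg).
Qed.

Lemma pcolumnP f k :
  T (f, k) <-> [/\ l2 f, l2 (wt a f), l2 (wt b f) & k = stack (wt a f) (wt b f)].
Proof.
split=> [[/= /(wpushP s1K r1K)[lf laf kl] /(wpushP s2K r2K)[_ lbf kr]]|].
  split=> //; apply/funext => -[j|j] /=.
    by rewrite -kl.
  by rewrite -kr.
move=> [lf laf lbf ->]; split=> /=.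
  by apply/(wpushP s1K r1K); split.
by apply/(wpushP s2K r2K); split.
Qed.

(** The two summands on the right need not be square-summable separately, so
    the two sums are merged before the weights change sides. *)
Lemma inner_pcolumn f k : l2 (wt a f) -> l2 (wt b f) -> l2 k ->
  inner (stack (wt a f) (wt b f)) k =
  inner f (fun i => wt a (k \o inl \o s1) i + wt b (k \o inr \o s2) i).
Proof.
move=> laf lbf lk; rewrite inner_stack//; have [lkl lkr] := (l2_sumtype k).1 lk.
have lkl1 : l2 (k \o inl \o s1) by apply: l2_comp lkl; exact: pcan_inj s1K.
have lkr2 : l2 (k \o inr \o s2) by apply: l2_comp lkr; exact: pcan_inj s2K.
rewrite /inner -(csumD (l2_inner laf lkl1) (l2_inner lbf lkr2)).
congr csum; apply/funext => i; rewrite /wt conjcD !conjcM !conjc_real; ring.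
Qed.

Lemma adjoint_pcolumn k h : adjoint T (k, h) <->
  [/\ l2 k, l2 h & h = fun i => wt a (k \o inl \o s1) i + wt b (k \o inr \o s2) i].
Proof.
split=> -[/= lk lh H]; split=> //=.
  apply: inner_ext => i; rewrite -inner_pcolumn//; last 2 first.
  - exact: l2_wt_basis.
  - exact: l2_wt_basis.
  apply/esym; apply: H; apply/pcolumnP.
  by split=> //; [exact: l2_basis|exact: l2_wt_basis|exact: l2_wt_basis].
by move=> f k' /pcolumnP[lf laf lbf ->]; rewrite inner_pcolumn// H.
Qed.

Lemma comp_adjoint_pcolumn : ocomp (adjoint T) T = diag sq.
Proof.
have tE f : (fun i => wt a (push r1 (wt a f) \o s1) i +
                      wt b (push r2 (wt b f) \o s2) i) = wt sq f.
  by rewrite (push_comp s1K) (push_comp s2K) !wt_wt wtD.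
apply/seteqP; split=> -[f h].
  move=> [k /= /pcolumnP[lf laf lbf kE] /adjoint_pcolumn[lk lh hE]].
  have hE' : h = wt sq f by rewrite hE kE -tE.
  by apply/diagP; split=> //; rewrite -hE'.
move=> /diagP[lf lsf ->]; have [laf lbf _ _] := l2_wt_sqr lf lsf.
exists (stack (wt a f) (wt b f)); first by apply/pcolumnP; split.
by apply/adjoint_pcolumn; split=> //; [apply/l2_stack|rewrite -tE].
Qed.

(** The entries of the modulus of T. *)
Let q i : R := Num.sqrt (sq i).

Lemma oabs_pcolumn : oabs T = diag q.
Proof.
rewrite /oabs comp_adjoint_pcolumn opow_diag; last first.
  by move=> i; rewrite addr_ge0 ?sqr_ge0.
congr diag; apply/funext => i; apply: powR12_sqrt.
by rewrite addr_ge0 ?sqr_ge0.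
Qed.

Hypotheses (a_gt0 : forall i, 0 < a i) (b_gt0 : forall i, 0 < b i).

Lemma sq_gt0 i : 0 < sq i.
Proof. by rewrite addr_gt0// exprn_gt0. Qed.

Lemma q_gt0 i : 0 < q i.
Proof. by rewrite sqrtr_gt0 sq_gt0. Qed.

Lemma q_sqr i : q i ^+ 2 = a i ^+ 2 + b i ^+ 2.
Proof. by rewrite sqr_sqrtr// ltW// sq_gt0. Qed.

(** The weights of the two components of the polar factor. *)
Let ua i : R := a i / q i.
Let ub i : R := b i / q i.

Lemma wt_polar1 f : wt ua (wt q f) = wt a f.
Proof. by rewrite wt_wt; congr wt; apply/funext => i; rewrite divfK ?gt_eqF ?q_gt0. Qed.

Lemma wt_polar2 f : wt ub (wt q f) = wt b f.
Proof. by rewrite wt_wt; congr wt; apply/funext => i; rewrite divfK ?gt_eqF ?q_gt0. Qed.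

Lemma ua_ub_sqr i : ua i ^+ 2 + ub i ^+ 2 = 1.
Proof. by rewrite !expr_div_n -mulrDl -q_sqr divff// expf_neq0// gt_eqF ?q_gt0. Qed.

Definition polar_map f : I + I -> C := stack (wt ua f) (wt ub f).

Lemma sqnorm_polar_map f : sqnorm (polar_map f) = sqnorm f.
Proof.
rewrite sqnorm_stack !sqnormE -esumD; last 2 first.
- by move=> i _; rewrite lee_fin nsq_ge0.
- by move=> i _; rewrite lee_fin nsq_ge0.
by apply: eq_esum => i _; rewrite -EFinD !nsq_wt -mulrDl ua_ub_sqr mul1r.
Qed.

Lemma norm2_polar_map f : norm2 (polar_map f) = norm2 f.
Proof. by rewrite /norm2 sqnorm_polar_map. Qed.

Lemma polar_map_axpy c f g : polar_map (axpy c f g) = axpy c (polar_map f) (polar_map g).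
Proof.
apply/funext => -[j|j]; rewrite /polar_map /axpy /= /push.
  by case: (r1 j) => [i|]; rewrite /wt ?mulr0 ?addr0//; ring.
by case: (r2 j) => [i|]; rewrite /wt ?mulr0 ?addr0//; ring.
Qed.

Definition polar_op : operator R I (I + I)%type :=
  [set fk | l2 fk.1 /\ fk.2 = polar_map fk.1].

Lemma polar_map_inj f : l2 f -> polar_map f = (fun=> 0) -> f = fun=> 0.
Proof.
move=> lf f0; apply: norm2_eq0 => //; rewrite -norm2_polar_map f0 norm2_sqr.
by rewrite rsum_ge0E => [|i]; rewrite nsq0// esum1.
Qed.

Lemma polar_map0 : polar_map (fun=> 0) = fun=> 0.
Proof.
apply/funext => -[j|j]; rewrite /polar_map /= /push /wt.
  by case: (r1 j) => // i; rewrite mulr0.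
by case: (r2 j) => // i; rewrite mulr0.
Qed.

Lemma ker_polar_op : ker polar_op = [set fun=> 0].
Proof.
apply/seteqP; split=> f; first by move=> [/= lf /esym]; exact: polar_map_inj.
by move=> ->; split=> /=; [exact: l2_0|rewrite polar_map0].
Qed.

Lemma ker_diag_q : ker (diag q) = [set fun=> 0].
Proof.
apply/seteqP; split=> f.
  move=> /diagP[_ _ f0]; apply/funext => i; have /esym/eqP := congr1 (@^~ i) f0.
  rewrite /wt mulf_eq0 => /orP[/eqP/complexI/eqP|/eqP//].
  by rewrite gt_eqF ?q_gt0.
move=> ->; apply/diagP; have w0 : wt q (fun=> 0) = (fun=> 0).
  by apply/funext => i; rewrite /wt mulr0.
by rewrite w0; split=> //; exact: l2_0.
Qed.

Lemma partial_isometry_polar_op : partial_isometry polar_op.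
Proof.
split.
- by apply/seteqP; split=> f; [move=> [g []]|move=> lf; exists (polar_map f)].
- by move=> f g g' [/= _ ->] [/= _ ->].
- move=> c f g f' g' [/= lf ->] [/= lf' ->]; split=> /=; first exact: l2_axpy.
  by rewrite polar_map_axpy.
- exists 1 => f g [/= lf ->]; rewrite mul1r norm2_polar_map; split=> //.
  by rewrite /l2 sqnorm_polar_map.
- by move=> f g [/= lf ->] _; exact: norm2_polar_map.
Qed.

Lemma l2_wt_q f : l2 (wt q f) <-> l2 (wt a f) /\ l2 (wt b f).
Proof.
split=> [lq|[/l2P la /l2P lb]].
  by split; apply: (l2_wt_le _ lq) => i; rewrite q_sqr ?lerDl ?lerDr sqr_ge0.
apply: l2_le (rsummableD la lb) => i.
by rewrite !nsq_wt q_sqr mulrDl.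
Qed.

Lemma polar_op_polar : T = ocomp polar_op (diag q).
Proof.
apply/seteqP; split=> -[f k].
  move=> /pcolumnP[lf laf lbf ->]; have lqf := (l2_wt_q f).2 (conj laf lbf).
  exists (wt q f); first by apply/diagP; split.
  by split=> //=; rewrite /polar_map wt_polar1 wt_polar2.
move=> [h /= /diagP[lf lqf ->] [/= _ ->]]; have [laf lbf] := (l2_wt_q f).1 lqf.
by apply/pcolumnP; split=> //; rewrite /polar_map wt_polar1 wt_polar2.
Qed.

(** Finitely supported vectors lie in the range of |T|, on which U |T| = T
    prescribes U; boundedness carries the formula over to all of l^2. *)
Lemma polar_unique U : partial_isometry U -> T = ocomp U (diag q) ->
  forall f g, U (f, g) -> g = polar_map f.
Proof.
move=> [domU funU linU [M boundU] _] TU f g Ufg.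
have lf : l2 f by rewrite -domU; exists g.
have [lg _] := boundU _ _ Ufg.
have trunc_polar D : finite_set D -> U (trunc D f, polar_map (trunc D f)).
  move=> finD; pose h := wt (fun i => (q i)^-1) (trunc D f).
  have qh : wt q h = trunc D f.
    apply/funext => i; rewrite /h /wt mulrA -rmorphM divff ?mul1r//.
    by rewrite gt_eqF ?q_gt0.
  have lh : l2 h by exact: l2_wt_trunc.
  have ltf : l2 (trunc D f) by exact: l2_trunc_finite.
  have [lah lbh] : l2 (wt a h) /\ l2 (wt b h) by apply/l2_wt_q; rewrite qh.
  have : T (h, stack (wt a h) (wt b h)) by apply/pcolumnP.
  rewrite TU => -[h' /= /diagP[_ _ ->]].
  by rewrite qh -(wt_polar1 h) -(wt_polar2 h) qh.
(* The error splits into the errors of U and of the formula on the tail of f. *)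
have close (e : R) y : 0 < e -> nsq (g y - polar_map f y) <= (2 * M ^+ 2 + 2) * e ^+ 2.
  move=> e0; have [D finD De] := trunc_dense lf e0.
  pose v := axpy (-1) (trunc D f) f.
  have lv : l2 v by apply: l2_axpy => //; exact: l2_trunc_finite.
  have [lw nw] := boundU _ _ (linU (-1) _ _ _ _ (trunc_polar D finD) Ufg).
  have le1 : nsq (axpy (-1) (polar_map (trunc D f)) g y) <= M ^+ 2 * e ^+ 2.
    apply: (le_trans (nsq_le_norm2 y lw)).
    apply: (@le_trans _ _ ((M * norm2 v) ^+ 2)).
      by rewrite lerXn2r ?nnegrE ?norm2_ge0// (le_trans _ nw) ?norm2_ge0.
    rewrite exprMn ler_wpM2l ?sqr_ge0// lerXn2r ?nnegrE ?norm2_ge0 ?ltW//.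
  have le2 : nsq (polar_map v y) <= e ^+ 2.
    have ls : l2 (polar_map v) by rewrite /l2 sqnorm_polar_map.
    apply: (le_trans (nsq_le_norm2 y ls)).
    by rewrite norm2_polar_map lerXn2r ?nnegrE ?norm2_ge0 ?ltW.
  have -> : g y - polar_map f y = axpy (-1) (polar_map (trunc D f)) g y + - polar_map v y.
    by rewrite /v polar_map_axpy /axpy; ring.
  apply: (le_trans (nsqD_le _ _)); rewrite nsqN; nra.
apply/funext => y; apply/eqP; rewrite -subr_eq0; apply/eqP/nsq_eq0/eqP.
apply/contraT => nz.
(* A nonzero coordinate of the difference is excluded by an e with
   e^2 = z / (2 c), for which the bound reads z <= z / 2. *)
have z0 : 0 < nsq (g y - polar_map f y) by rewrite lt0r nz nsq_ge0.
have c0 : 0 < 2 * M ^+ 2 + 2 :> R by have := sqr_ge0 M; lra.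
set z := nsq _ in z0 close *; set c := 2 * M ^+ 2 + 2 in c0 close *.
have e0 : 0 < Num.sqrt (z / (2 * c)) by rewrite sqrtr_gt0 divr_gt0// mulr_gt0.
have := close _ y e0; rewrite sqr_sqrtr; last first.
  by apply: ltW; rewrite divr_gt0// mulr_gt0.
have -> : c * (z / (2 * c)) = z / 2 by field; rewrite gt_eqF.
by rewrite -/z leNgt gtr_pMr// invf_lt1// ltr1n.
Qed.

Lemma polar_factor_pcolumn : polar_factor T = polar_op.
Proof.
rewrite /polar_factor; apply: xget_unique.
  split; first exact: partial_isometry_polar_op.
    by rewrite oabs_pcolumn ker_polar_op ker_diag_q.
  by rewrite oabs_pcolumn -polar_op_polar.
move=> U [isoU _]; rewrite oabs_pcolumn => TU.
have U_sph := polar_unique isoU TU.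
have [domU _ _ _ _] := isoU.
apply/seteqP; split=> -[f g] /=.
  by move=> Ufg; split=> /=; [rewrite -domU; exists g|exact: U_sph].
move=> [/= lf ->]; have : dom U f by rewrite domU.
by move=> [k Ufk]; rewrite -(U_sph _ _ Ufk).
Qed.

(** |T| U_k first shifts and then multiplies, so its weight carries the
    entry of |T| at the shifted index. *)
Lemma mean_component (s : I -> I) (r : I -> option I) (sK : pcancel s r)
    (rK : ocancel r s) (u : I -> R) (lam : R) (V : operator R I I) :
  (forall i, u i ^+ 2 <= 1) ->
  (forall f g, V (f, g) <-> l2 f /\ g = push r (wt u f)) ->
  forall f g,
  oadd (oscale lam (ocomp V (diag q))) (oscale (1 - lam) (ocomp (diag q) V)) (f, g) <->
  [/\ l2 f, l2 (wt q f), l2 (wt (fun i => q (s i) * u i) f) &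
      g = push r (wt (fun i => lam * (u i * q i) + (1 - lam) * (q (s i) * u i)) f)].
Proof.
move=> u1 VP f g; have sumE : push r (wt (fun i => lam * (u i * q i) +
      (1 - lam) * (q (s i) * u i)) f) = (fun j =>
    (lam%:C)%C * push r (wt u (wt q f)) j +
    ((1 - lam)%:C)%C * wt q (push r (wt u f)) j).
  rewrite (wt_push rK); apply/funext => j; rewrite /push /wt /=.
  case: (r j) => [i|]; last by rewrite !mulr0 addr0.
  by rewrite rmorphD !rmorphM; ring.
split.
  move=> [g1 [g2 [[k1 /= [h /= /diagP[lf lqf hE] /VP[_ k1E]] g1E]]]].
  move=> [k2 /= [h' /= /VP[_ h'E] /diagP[lh' lqh' k2E]] g2E] gE.
  split=> //.
    rewrite -wt_wt; apply: (l2_push sK rK _).1.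
    by rewrite -(wt_push rK) -h'E.
  by rewrite sumE gE g1E g2E k1E k2E hE h'E.
move=> [lf lqf lcf ->].
exists (fun j => (lam%:C)%C * push r (wt u (wt q f)) j).
exists (fun j => ((1 - lam)%:C)%C * wt q (push r (wt u f)) j); split=> //=.
  exists (push r (wt u (wt q f))) => //; exists (wt q f).
    by apply/diagP; split.
  by apply/VP; split.
exists (wt q (push r (wt u f))) => //; exists (push r (wt u f)).
  by apply/VP; split.
apply/diagP; split=> //.
  apply: (l2_push sK rK _).2; apply: (l2_wt_le (d' := fun=> 1)).
    by move=> i; rewrite expr1n.
  by rewrite (_ : wt _ f = f)//; apply/funext => i; rewrite /wt mul1r.
by rewrite (wt_push rK); apply: (l2_push sK rK _).2; rewrite wt_wt.
Qed.

Variable lam : R.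
Hypotheses (lam_gt0 : 0 < lam) (lam_lt1 : lam < 1).

(** The weights of |T| U_1 and |T| U_2. *)
Let c1 i : R := q (s1 i) * ua i.
Let c2 i : R := q (s2 i) * ub i.
(** The weights of the mean transform. *)
Let a' i : R := lam * a i + (1 - lam) * c1 i.
Let b' i : R := lam * b i + (1 - lam) * c2 i.
Local Notation M := (spherical_mean_transform lam (C1, C2)).

Lemma mean1P f g : M.1 (f, g) <->
  [/\ l2 f, l2 (wt q f), l2 (wt c1 f) & g = push r1 (wt a' f)].
Proof.
rewrite /spherical_mean_transform /= polar_factor_pcolumn oabs_pcolumn.
rewrite (mean_component s1K r1K (u := ua)).
- rewrite (_ : (fun i => lam * (ua i * q i) + _) = a')//; apply/funext => i.
  by rewrite /a' /ua divfK// gt_eqF ?q_gt0.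
- by move=> i; rewrite -(ua_ub_sqr i) lerDl sqr_ge0.
- move=> f' g'; split=> [[k [/= lf' ->] ->]//|[lf' ->]].
  by exists (polar_map f').
Qed.

Lemma mean2P f g : M.2 (f, g) <->
  [/\ l2 f, l2 (wt q f), l2 (wt c2 f) & g = push r2 (wt b' f)].
Proof.
rewrite /spherical_mean_transform /= polar_factor_pcolumn oabs_pcolumn.
rewrite (mean_component s2K r2K (u := ub)).
- rewrite (_ : (fun i => lam * (ub i * q i) + _) = b')//; apply/funext => i.
  by rewrite /b' /ub divfK// gt_eqF ?q_gt0.
- by move=> i; rewrite -(ua_ub_sqr i) lerDr sqr_ge0.
- move=> f' g'; split=> [[k [/= lf' ->] ->]//|[lf' ->]].
  by exists (polar_map f').
Qed.

Lemma c1_gt0 i : 0 < c1 i.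
Proof. by rewrite mulr_gt0 ?divr_gt0 ?q_gt0. Qed.

Lemma c2_gt0 i : 0 < c2 i.
Proof. by rewrite mulr_gt0 ?divr_gt0 ?q_gt0. Qed.

(** As all weights are positive, a combination with positive coefficients
    dominates each of its terms: the domain of the combined shifts is not
    larger than the intersection of the domains of the terms. *)
Lemma mean_weight_l2 f : l2 f ->
  [/\ l2 (wt q f), l2 (wt c1 f) & l2 (wt c2 f)] <->
  l2 (wt a' f) /\ l2 (wt b' f).
Proof.
have lam'_gt0 : 0 < 1 - lam by rewrite subr_gt0.
have comb_sqr (x y : R) : (lam * x + (1 - lam) * y) ^+ 2 <=
    (2 * lam ^+ 2 + 2 * (1 - lam) ^+ 2) * (x ^+ 2 + y ^+ 2).
  have := sqr_ge0 (lam * x - (1 - lam) * y); have := sqr_ge0 (lam * y);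
  have := sqr_ge0 ((1 - lam) * x); nra.
have comb_le (l m x y : R) : 0 < l -> 0 < m -> 0 < x -> 0 < y ->
    x ^+ 2 <= l ^- 2 * (l * x + m * y) ^+ 2.
  move=> l0 m0 x0 y0; rewrite -exprVn -exprMn lerXn2r ?nnegrE//; first exact: ltW.
    by rewrite mulr_ge0 ?invr_ge0 ?addr_ge0 ?mulr_ge0 ?ltW.
  rewrite -[leLHS](mulKf (lt0r_neq0 l0)) ler_pM2l ?invr_gt0// lerDl.
  by apply: ltW; rewrite mulr_gt0.
have comb_x x y := comb_le lam (1 - lam) x y lam_gt0 lam'_gt0.
have comb_y (x y : R) : 0 < x -> 0 < y ->
    y ^+ 2 <= (1 - lam) ^- 2 * (lam * x + (1 - lam) * y) ^+ 2.
  by move=> x0 y0; rewrite (addrC (lam * x)); exact: comb_le.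
move=> lf; split=> [[/l2_wt_q[laf lbf] lc1 lc2]|[la' lb']].
  by split; [apply: (l2_wt_comb _ laf lc1)|apply: (l2_wt_comb _ lbf lc2)] => i;
    exact: comb_sqr.
have K1 : 0 <= lam ^- 2 by rewrite invr_ge0 sqr_ge0.
have K2 : 0 <= (1 - lam) ^- 2 by rewrite invr_ge0 sqr_ge0.
split.
- apply/l2_wt_q; split.
    apply: (l2_wt_comb (K := lam ^- 2) _ la' lb') => i.
    by apply: le_trans (comb_x _ _ (a_gt0 i) (c1_gt0 i)) _;
      rewrite ler_wpM2l// lerDl sqr_ge0.
  apply: (l2_wt_comb (K := lam ^- 2) _ la' lb') => i.
  by apply: le_trans (comb_x _ _ (b_gt0 i) (c2_gt0 i)) _;
    rewrite ler_wpM2l// lerDr sqr_ge0.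
- apply: (l2_wt_comb (K := (1 - lam) ^- 2) _ la' lb') => i.
  by apply: le_trans (comb_y _ _ (a_gt0 i) (c1_gt0 i)) _;
    rewrite ler_wpM2l// lerDl sqr_ge0.
- apply: (l2_wt_comb (K := (1 - lam) ^- 2) _ la' lb') => i.
  by apply: le_trans (comb_y _ _ (b_gt0 i) (c2_gt0 i)) _;
    rewrite ler_wpM2l// lerDr sqr_ge0.
Qed.

Lemma same_pair_mean : same_pair M (wpush r1 a', wpush r2 b').
Proof.
apply/seteqP; split=> -[f k] [/=].
  move=> /mean1P[lf lqf lc1 k1] /mean2P[_ _ lc2 k2].
  have [la' lb'] := (mean_weight_l2 lf).1 (And3 lqf lc1 lc2).
  by split; [apply/(wpushP s1K r1K)|apply/(wpushP s2K r2K)].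
move=> /(wpushP s1K r1K)[lf la' k1] /(wpushP s2K r2K)[_ lb' k2].
have [lqf lc1 lc2] := (mean_weight_l2 lf).2 (conj la' lb').
by split; [apply/mean1P|apply/mean2P].
Qed.

Lemma dom_meanP f : dom (pcolumn M) f <->
  [/\ l2 f, l2 (wt q f), l2 (wt c1 f) & l2 (wt c2 f)].
Proof.
split=> [[k [/= /mean1P[lf lqf lc1 _] /mean2P[_ _ lc2 _]]]|[lf lqf lc1 lc2]].
  by split.
exists (stack (wt a' f) (wt b' f)); split=> /=.
  by apply/mean1P; split.
by apply/mean2P; split.
Qed.

Lemma dom_mean f : dom (pcolumn M) f <->
  (\esum_(x in [set: I]) (nsq (f x) * (1 + a x ^+ 2 + b x ^+ 2 +
     (a x ^+ 2 * sq (s1 x) + b x ^+ 2 * sq (s2 x)) / sq x))%:E < +oo)%E.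
Proof.
have c1E i : c1 i ^+ 2 = a i ^+ 2 * sq (s1 i) / sq i.
  by rewrite exprMn expr_div_n !q_sqr -/(sq _) -/(sq _); ring.
have c2E i : c2 i ^+ 2 = b i ^+ 2 * sq (s2 i) / sq i.
  by rewrite exprMn expr_div_n !q_sqr -/(sq _) -/(sq _); ring.
pose F i := nsq (f i) + nsq (wt q f i) + (nsq (wt c1 f i) + nsq (wt c2 f i)).
have F0 i : 0 <= F i by apply: addr_ge0; apply: addr_ge0; exact: nsq_ge0.
rewrite (eq_esum (b := fun i => (F i)%:E)); last first.
  by move=> i _; rewrite /F !nsq_wt q_sqr c1E c2E; congr EFin; ring.
apply: (iff_trans (dom_meanP f)); apply: iff_trans (rsummable_ge0 F0).
split=> [[/l2P lf /l2P lqf /l2P lc1 /l2P lc2]|H].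
  exact: (rsummableD (rsummableD lf lqf) (rsummableD lc1 lc2)).
by split; apply: (l2_le _ H) => i; rewrite /F; have := nsq_ge0 (f i);
  have := nsq_ge0 (wt q f i); have := nsq_ge0 (wt c1 f i);
  have := nsq_ge0 (wt c2 f i); lra.
Qed.

End pair.

(** * Two-variable weighted shifts *)

Section concrete.
Context {R : realType}.
Local Notation C := R[i].
Local Notation X := (nat * nat)%type.

Section determined.
Variable I : choiceType.

(** The values on all e_x determine the weight at y, and determine the symbol
    at y unless the weight vanishes there, in which case it is immaterial. *)
Lemma wcomp_determined (f g : I -> I) (w v : I -> C) :
  (forall x y, w y * basis x (f y) = v y * basis x (g y)) ->
  wcomp f w = wcomp g v.
Proof.
move=> E; suff comp_eq h : (fun y => w y * h (f y)) = (fun y => v y * h (g y)).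
  by apply/seteqP; split=> -[h k] [/= lh lk kE]; split=> //=; rewrite kE comp_eq.
apply/funext => y; have [wy0|wy0] := eqVneq (w y) 0.
  have := E (g y) y; rewrite wy0 mul0r /basis eqxx mulr1 => <-.
  by rewrite !mul0r.
have := E (f y) y; rewrite /basis eqxx mulr1.
have [->|_] := eqVneq (g y) (f y); first by rewrite mulr1 => ->.
by rewrite mulr0 => /eqP; rewrite (negPf wy0).
Qed.

Lemma wcomp_pair_determined (f1 f2 g1 g2 : I -> I) (w1 w2 v1 v2 : I -> C) :
  same_pair (wcomp f1 w1, wcomp f2 w2) (wcomp g1 v1, wcomp g2 v2) ->
  (forall x, dom (pcolumn (wcomp f1 w1, wcomp f2 w2)) (basis x)) ->
  wcomp f1 w1 = wcomp g1 v1 /\ wcomp f2 w2 = wcomp g2 v2.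
Proof.
move=> E domE; split; apply: wcomp_determined => x y.
  have [k Hk] := domE x; have [[/= _ _ k1] _] := Hk.
  move: Hk; rewrite E => -[[/= _ _ k2] _].
  by have := congr1 (@^~ y) (esym k1); rewrite k2.
have [k Hk] := domE x; have [_ [/= _ _ k1]] := Hk.
move: Hk; rewrite E => -[_ [/= _ _ k2]].
by have := congr1 (@^~ y) (esym k1); rewrite k2.
Qed.

End determined.

Definition east (x : X) : X := (x.1.+1, x.2).
Definition north (x : X) : X := (x.1, x.2.+1).
Definition unshift1 (x : X) : option X := if x.1 is n.+1 then Some (n, x.2) else None.
Definition unshift2 (x : X) : option X := if x.2 is m.+1 then Some (x.1, m) else None.

Lemma eastK : pcancel east unshift1. Proof. by case. Qed.
Lemma northK : pcancel north unshift2. Proof. by case. Qed.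
Lemma unshift1K : ocancel unshift1 east. Proof. by case=> -[|n] m. Qed.
Lemma unshift2K : ocancel unshift2 north. Proof. by case=> n [|m]. Qed.

Lemma wcomp_shift1 (a : X -> R) : wcomp phi1 (omega1 a) = wpush unshift1 a.
Proof.
have E f : (fun x => omega1 a x * f (phi1 x)) = push unshift1 (wt a f).
  by apply/funext => -[[|n] m]; rewrite /omega1 /push /= ?mul0r.
by apply/seteqP; split=> -[f g] [/= lf lg gE]; split=> //=; rewrite gE E.
Qed.

Lemma wcomp_shift2 (b : X -> R) : wcomp phi2 (omega2 b) = wpush unshift2 b.
Proof.
have E f : (fun x => omega2 b x * f (phi2 x)) = push unshift2 (wt b f).
  by apply/funext => -[n [|m]]; rewrite /omega2 /push /= ?mul0r.
by apply/seteqP; split=> -[f g] [/= lf lg gE]; split=> //=; rewrite gE E.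
Qed.

Lemma wpush_dense (I J : choiceType) (s : I -> J) (r : J -> option I)
    (sK : pcancel s r) (rK : ocancel r s) (a : I -> R) :
  densely_defined (wpush r a).
Proof.
apply: densely_defined_finite => D f finD.
exists (push r (wt a (trunc D f))); apply/(wpushP sK rK).
by split=> //; [exact: l2_trunc_finite|exact: l2_wt_trunc].
Qed.

(** Any pair of weighted composition operators representing T equals the pair
    of shifts, so the criterion for the shifts decides. *)
Lemma sph_hyponormal_shift (p : R) (T : opair X) (a b : X -> R) : 0 < p ->
  same_pair T (wshift a b) ->
  sph_hyponormal p T <->
  forall n m, west a (n, m) ^+ 2 + south b (n, m) ^+ 2 <=
    a (n, m) ^+ 2 + b (n, m) ^+ 2.
Proof.
move=> p0 TE.
have componentsE : sph_hyponormal_components p (wcomp phi1 (omega1 a))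
    (wcomp phi2 (omega2 b)) <-> forall n m, west a (n, m) ^+ 2 +
    south b (n, m) ^+ 2 <= a (n, m) ^+ 2 + b (n, m) ^+ 2.
  rewrite wcomp_shift1 wcomp_shift2.
  rewrite (sph_components_wpush eastK unshift1K northK unshift2K a b p0).
  by split=> [H n m|H [n m]]; [have := H (n, m)|have := H n m];
    case: n {H} => [|n]; case: m => [|m].
split=> [[f1 [f2 [w1 [w2 [TE' _ _ H]]]]]|H].
  apply/componentsE.
  have [||E1 E2] := @wcomp_pair_determined _ phi1 phi2 f1 f2
    (omega1 a) (omega2 b) w1 w2; last by rewrite E1 E2.
    by rewrite /same_pair -[pcolumn (wcomp phi1 _, _)]TE.
  move=> x; rewrite wcomp_shift1 wcomp_shift2.
  exists (stack unshift1 unshift2 (wt a (basis x)) (wt b (basis x))).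
  apply/(pcolumnP eastK unshift1K northK unshift2K).
  by split=> //; [exact: l2_basis|exact: l2_wt_basis|exact: l2_wt_basis].
exists phi1, phi2, (omega1 a), (omega2 b); split=> //.
- rewrite wcomp_shift1; exact: (wpush_dense eastK unshift1K).
- rewrite wcomp_shift2; exact: (wpush_dense northK unshift2K).
- exact/componentsE.
Qed.

Lemma sqrt_div (x y : R) : 0 <= x -> 0 <= y ->
  Num.sqrt (x / y) = Num.sqrt x / Num.sqrt y.
Proof. by move=> x0 y0; rewrite sqrtrM// sqrtrV. Qed.

Section mean.
Variables (a b : X -> R) (lam : R).
Hypotheses (a_gt0 : forall x, 0 < a x) (b_gt0 : forall x, 0 < b x).
Hypotheses (lam_gt0 : 0 < lam) (lam_lt1 : lam < 1).

Lemma sqsum_gt0 x : 0 < sqsum a b x.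
Proof. by rewrite addr_gt0// exprn_gt0. Qed.

Lemma mean_coef1_gt0 x : 0 < mean_coef1 lam a b x.
Proof.
rewrite /mean_coef1 addrC ltr_wpDr// mulr_ge0 ?sqrtr_ge0// subr_ge0.
exact: ltW.
Qed.

Lemma mean_coef2_gt0 x : 0 < mean_coef2 lam a b x.
Proof.
rewrite /mean_coef2 addrC ltr_wpDr// mulr_ge0 ?sqrtr_ge0// subr_ge0.
exact: ltW.
Qed.

Lemma same_pair_mean_shift :
  same_pair (spherical_mean_transform lam (wshift a b))
    (wshift (mean_weight1 lam a b) (mean_weight2 lam a b)).
Proof.
have s_ge0 x : 0 <= sqsum a b x by rewrite ltW// sqsum_gt0.
rewrite /wshift !wcomp_shift1 !wcomp_shift2.
have := same_pair_mean eastK unshift1K northK unshift2K a_gt0 b_gt0 lam_gt0 lam_lt1.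
congr (same_pair _ (wpush _ _, wpush _ _)); apply/funext => x.
  by rewrite /mean_weight1 /mean_coef1 sqrt_div// /sqsum; ring.
by rewrite /mean_weight2 /mean_coef2 sqrt_div// /sqsum; ring.
Qed.

Lemma dom_mean_shift :
  dom (pcolumn (spherical_mean_transform lam (wshift a b))) =
  [set f | (\esum_(x in [set: X])
     (Normc.normc (f x) ^+ 2 * mean_density a b x)%:E < +oo)%E].
Proof.
rewrite /wshift wcomp_shift1 wcomp_shift2; apply/seteqP.
have E f := dom_mean eastK unshift1K northK unshift2K a_gt0 b_gt0 lam f.
have normE (f : X -> C) : (\esum_(x in [set: X])
    (Normc.normc (f x) ^+ 2 * mean_density a b x)%:E =
    \esum_(x in [set: X]) (nsq (f x) * mean_density a b x)%:E)%E.
  by apply: eq_esum => x _; rewrite normc_sqr.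
by split=> f /=; rewrite normE => /E.
Qed.

End mean.

(** The integral of t^k (t - c)^2 over the half-line is nonnegative; the
    choice c = s_(k+1) / s_k is optimal. *)
Lemma stieltjes_log_convex (s : nat -> R) k : (forall k, 0 < s k) ->
  stieltjes_moment s -> s k.+1 ^+ 2 <= s k * s k.+2.
Proof.
move=> s0 [nu sE]; pose c := s k.+1 / s k.
have c0 : 0 <= c by rewrite ltW// divr_gt0.
have mpow j : measurable_fun (`[0%R, +oo[ : set (measurableTypeR R))
    (fun t => (t ^+ j)%:E).
  by apply/measurable_EFinP; apply: measurable_funX; exact: measurable_id.
have pow0 j (t : R) : `[0, +oo[%classic t -> 0 <= t ^+ j.
  by rewrite /= in_itv /= andbT => t0; exact: exprn_ge0.
have mI : measurable (`[0%R, +oo[%classic : set (measurableTypeR R)) by exact: measurable_itv.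
have : (\int[nu]_(t in `[0%R, +oo[) ((2 * c)%:E * (t ^+ k.+1)%:E) <=
  \int[nu]_(t in `[0%R, +oo[) ((t ^+ k.+2)%:E + (c ^+ 2)%:E * (t ^+ k)%:E))%E.
  apply: ge0_le_integral => //.
  - by move=> t t0; rewrite -EFinM lee_fin mulr_ge0 ?pow0// mulr_ge0.
  - exact: measurable_funeM.
  - by apply: emeasurable_funD => //; exact: measurable_funeM.
  - move=> t t0; rewrite -!EFinM -EFinD lee_fin -subr_ge0.
    rewrite (_ : _ - _ = t ^+ k * (t - c) ^+ 2); last by rewrite !exprS; ring.
    by apply: mulr_ge0; [exact: pow0|exact: sqr_ge0].
rewrite ge0_integralZl_EFin//; last 2 first.
- by move=> t t0; rewrite lee_fin pow0.
- by rewrite mulr_ge0.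
rewrite ge0_integralD//; last 3 first.
- by move=> t t0; rewrite lee_fin pow0.
- by move=> t t0; rewrite -EFinM lee_fin; apply: mulr_ge0; [exact: sqr_ge0|exact: pow0].
- exact: measurable_funeM.
rewrite ge0_integralZl_EFin//; last 2 first.
- by move=> t t0; rewrite lee_fin pow0.
- exact: sqr_ge0.
rewrite -!sE -!EFinM -EFinD lee_fin /c => H.
have sk := s0 k.
(* After multiplication by s_k the inequality is free of denominators. *)
have {}H : s k * (2 * (s k.+1 / s k) * s k.+1) <=
    s k * (s k.+2 + (s k.+1 / s k) ^+ 2 * s k) by rewrite ler_pM2l.
have E1 : s k * (2 * (s k.+1 / s k) * s k.+1) = 2 * s k.+1 ^+ 2.
  by field; rewrite gt_eqF.
have E2 : s k * (s k.+2 + (s k.+1 / s k) ^+ 2 * s k) = s k * s k.+2 + s k.+1 ^+ 2.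
  by field; rewrite gt_eqF.
by move: H; rewrite E1 E2; lra.
Qed.

Section moments.
Variables (a b : X -> R) (lam : R).
Hypotheses (a_gt0 : forall x, 0 < a x) (b_gt0 : forall x, 0 < b x).
Hypotheses (lam_gt0 : 0 < lam) (lam_lt1 : lam < 1).
Hypothesis ab_diag : forall n m : nat, a (n.+1, m) = a (n, m.+1) /\
                       b (n.+1, m) = b (n, m.+1).
Hypothesis ab_moment : forall m : nat,
  stieltjes_moment (fun n => a (n, m) ^+ 2 + b (n, m) ^+ 2).

Let ca := mean_coef1 lam a b.
Let cb := mean_coef2 lam a b.

Lemma sqsum_diag n m : sqsum a b (n.+1, m) = sqsum a b (n, m.+1).
Proof. by rewrite /sqsum; have [-> ->] := ab_diag n m. Qed.

Lemma mean_coef12 n m : ca (n, m) = cb (n, m).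
Proof. by rewrite /ca /cb /mean_coef1 /mean_coef2 /= sqsum_diag. Qed.

Lemma mean_coef1_diag n m : ca (n.+1, m) = ca (n, m.+1).
Proof. by rewrite /ca /mean_coef1 /= !sqsum_diag. Qed.

Lemma mean_coef1_le n m : ca (n, m) <= ca (n.+1, m).
Proof.
have s0 x : 0 < sqsum a b x by exact: sqsum_gt0.
have := @stieltjes_log_convex (fun n => sqsum a b (n, m)) n (fun=> s0 _) (ab_moment m).
move=> le_s; rewrite /ca /mean_coef1 lerD2r ler_wpM2l ?subr_ge0 ?(ltW lam_lt1)//.
rewrite ler_wsqrtr//= ler_pdivrMr// mulrAC ler_pdivlMr// -expr2.
by rewrite [leRHS]mulrC.
Qed.

(** The coefficients at the western and southern neighbours are at most the
    coefficient at (n, m), which factors out of both sides. *)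
Lemma mean_preserves_hyponormal :
  (forall n m, west a (n, m) ^+ 2 + south b (n, m) ^+ 2 <=
    a (n, m) ^+ 2 + b (n, m) ^+ 2) ->
  forall n m, west (fun x => ca x ^+ 2 * a x ^+ 2) (n, m) +
         south (fun x => cb x ^+ 2 * b x ^+ 2) (n, m)
           <= ca (n, m) ^+ 2 * a (n, m) ^+ 2 + cb (n, m) ^+ 2 * b (n, m) ^+ 2.
Proof.
move=> H n m; rewrite -mean_coef12 -mulrDr.
have ca_ge0 x : 0 <= ca x by apply: ltW; exact: mean_coef1_gt0.
apply: (@le_trans _ _ (ca (n, m) ^+ 2 * (west a (n, m) ^+ 2 + south b (n, m) ^+ 2))).
  rewrite mulrDr lerD//.
    case: n {H} => [|n]; first by rewrite /west /= expr0n mulr0.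
    by rewrite /west /= ler_wpM2r ?sqr_ge0// lerXn2r ?nnegrE// mean_coef1_le.
  case: m {H} => [|m]; first by rewrite /south /= expr0n mulr0.
  rewrite /south /= -mean_coef12 ler_wpM2r ?sqr_ge0// lerXn2r ?nnegrE//.
  by rewrite -mean_coef1_diag mean_coef1_le.
by rewrite ler_wpM2l ?sqr_ge0.
Qed.

End moments.
End concrete.

Theorem corollary39 (R : realType) (alpha beta : nat * nat -> R) (lam p : R)
    (alpha_gt0 : forall x, 0 < alpha x) (beta_gt0 : forall x, 0 < beta x)
    (lam_gt0 : 0 < lam) (lam_lt1 : lam < 1) (p_gt0 : 0 < p) (p_le1 : p <= 1) :
  let S := wshift alpha beta in
  let M := spherical_mean_transform lam S in
  let alpha' := mean_weight1 lam alpha beta in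
  let beta' := mean_weight2 lam alpha beta in
  let ca := mean_coef1 lam alpha beta in
  let cb := mean_coef2 lam alpha beta in
  [/\
    (* (i) *)
    sph_hyponormal p S <->
      (forall n m : nat,
         west alpha (n, m) ^+ 2 + south beta (n, m) ^+ 2
           <= alpha (n, m) ^+ 2 + beta (n, m) ^+ 2),
    (* (ii) *)
    [/\ forall x, 0 < alpha' x,
        forall x, 0 < beta' x,
        same_pair M (wshift alpha' beta') &
        dom (pcolumn M) =
          [set f | (\esum_(x in [set: nat * nat])
             (Normc.normc (f x) ^+ 2 * mean_density alpha beta x)%:E < +oo)%E]],
    (* (iii) *)
    sph_hyponormal p M <->
      (forall n m : nat,
         west (fun x => ca x ^+ 2 * alpha x ^+ 2) (n, m) +
         south (fun x => cb x ^+ 2 * beta x ^+ 2) (n, m)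
           <= ca (n, m) ^+ 2 * alpha (n, m) ^+ 2 +
              cb (n, m) ^+ 2 * beta (n, m) ^+ 2) &
    (* (iv) *)
    (forall n m : nat, alpha (n.+1, m) = alpha (n, m.+1) /\
                       beta (n.+1, m) = beta (n, m.+1)) ->
    (forall m : nat,
       stieltjes_moment (fun n => alpha (n, m) ^+ 2 + beta (n, m) ^+ 2)) ->
    sph_hyponormal p S -> sph_hyponormal p M].
Proof.
move=> S M alpha' beta' ca cb.
have ME : same_pair M (wshift alpha' beta') by exact: same_pair_mean_shift.
have hypM := sph_hyponormal_shift p_gt0 ME.
have hypS : sph_hyponormal p S <-> _ := sph_hyponormal_shift p_gt0 (erefl _).
have iii : sph_hyponormal p M <->
    (forall n m : nat,
       west (fun x => ca x ^+ 2 * alpha x ^+ 2) (n, m) +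
       south (fun x => cb x ^+ 2 * beta x ^+ 2) (n, m)
         <= ca (n, m) ^+ 2 * alpha (n, m) ^+ 2 +
            cb (n, m) ^+ 2 * beta (n, m) ^+ 2).
  apply: iff_trans hypM _.
  have E n m : west (fun x => ca x ^+ 2 * alpha x ^+ 2) (n, m) = west alpha' (n, m) ^+ 2 /\
      south (fun x => cb x ^+ 2 * beta x ^+ 2) (n, m) = south beta' (n, m) ^+ 2.
    by split; [case: n => [|n]|case: m => [|m]]; rewrite /west /south /= ?expr0n//
      exprMn.
  by split=> H n m; have := H n m; have [-> ->] := E n m; rewrite !exprMn.
split=> //.
- split=> //.
  + by move=> x; rewrite mulr_gt0// mean_coef1_gt0.
  + by move=> x; rewrite mulr_gt0// mean_coef2_gt0.
  + exact: dom_mean_shift.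
- move=> ab_diag ab_moment /hypS H; apply/iii.
  exact: mean_preserves_hyponormal.
Qed.
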